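(* Let $\mathfrak{e} \subset \mathbb{R}$ be a compact set that is not finite, and fix an integer $n \ge 1$. Let $t_n = \|T_n\|_{\mathfrak{e}}$, where $T_n$ is the degree $n$ Chebyshev polynomial of $\mathfrak{e}$. Then $t_n = 2C(\mathfrak{e})^n$ if and only if there is a polynomial $P$ of degree $n$ such that $$\mathfrak{e} = P^{-1}([-2,2]) = \{z \in \mathbb{C} : P(z) \in [-2,2]\}.$$
   Context: For a compact, not finite set $\mathfrak{e}\subset\mathbb{C}$ and a continuous function $f$ on $\mathfrak{e}$, $\|f\|_{\mathfrak{e}} = \sup_{z\in\mathfrak{e}}|f(z)|$. The Chebyshev polynomial $T_n$ of $\mathfrak{e}$ is the unique monic polynomial of degree $n$ (complex coefficients allowed) minimizing $\|P\|_{\mathfrak{e}}$ over all monic polynomials $P$ of degree $n$. $C(\mathfrak{e})$ denotes the logarithmic capacity of $\mathfrak{e}$. The preimage $P^{-1}([-2,2])$ is taken in all of $\mathbb{C}$, not just in $\mathbb{R}$. *)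

(* Defs.v *)
From HB Require Import structures.
From mathcomp Require Export all_boot all_order all_algebra complex.
From mathcomp Require Export all_classical all_reals all_analysis.
Export Order.TTheory GRing.Theory Num.Theory numFieldNormedType.Exports.
Export ComplexField.

Set Implicit Arguments.
Unset Strict Implicit.
Unset Printing Implicit Defensive.

Local Open Scope classical_set_scope.
Local Open Scope ring_scope.
Local Open Scope complex_scope.

(* MathComp-Analysis puts the usual topology of the complex plane on the alias
   R[i]^o of R[i], so subsets of the plane have type [set R[i]^o]. *)

Definition realAxis (R : realType) : set R[i]^o := range (fun x : R => x%:C).
Arguments realAxis : clear implicits.

Definition supnorm (R : realType) (e : set R[i]^o) (f : R[i] -> R[i]) : R :=
  sup [set Normc.normc (f z) | z in e].

Definition is_chebyshev (R : realType) (e : set R[i]^o) (n : nat)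
    (T : {poly R[i]}) : Prop :=
  [/\ T \is monic, size T = n.+1 &
      forall P : {poly R[i]}, P \is monic -> size P = n.+1 ->
        supnorm e (horner T) <= supnorm e (horner P)].

Definition borelC (R : realType) := g_sigma_algebraType (@open R[i]^o).

(* The double integral of log (1 / |z - w|); the integrand is +oo on the
   diagonal since lne 0 = -oo. *)
Definition log_energy (R : realType) (mu : probability (borelC R) R) : \bar R :=
  (\int[mu]_z \int[mu]_w (- lne (Normc.normc ((z : R[i]) - w))%:E))%E.

(* The Robin constant inf I(mu), over the Borel probability measures mu carried
   by e. It is +oo when every such mu has infinite energy, in particular when e
   is polar; for nonempty compact e it is never -oo. *)
Definition robin (R : realType) (e : set R[i]^o) : \bar R :=
  ereal_inf [set log_energy mu | mu in
    [set mu : probability (borelC R) R | mu (e : set (borelC R)) = 1%E]].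

(* C(e) = exp (- inf I(mu)), equal to 0 for polar e as expeR -oo = 0. *)
Definition capacity (R : realType) (e : set R[i]^o) : R :=
  fine (expeR (- robin e)).

(* Main.v *)
From HB Require Import structures.
Require Import Defs.
From mathcomp Require Import perm measurable_realfun ring lra zify.

(* Let p(w) = w^2 - 2, so that p^-1([-2,2]) = [-2,2]. If P has degree n and
   leading coefficient c, the iterates F_k = p^k o P (essentially the Chebyshev
   polynomials of degree 2^k composed with P) have degree n 2^k, leading
   coefficient c^(2^k), and F_k^-1([-2,2]) = P^-1([-2,2]) =: E.
   - If e is contained in E, then C(e)^n <= 1/|c|: a monic polynomial of degree m
     bounded by M on e forces C(e)^m <= M (write the Vandermonde determinant of
     points of e with powers of that polynomial, and integrate in each point),
     and F_k / c^(2^k) is bounded by 2 / |c|^(2^k) on e.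
   - The inequality is strict if e is a compact real set missing a point z0 of E:
     F_k has many zeros near z0, and replacing pairs of them by a quadratic
     polynomial that is smaller on e beats the factor 2.
   - If e = E is real, then C(e)^n >= 1/|c|: the pull-back by F_k of the uniform
     law on [-2,2] has an energy of at most (ln |c|) / n + (ln 2) / (n 2^k).
   Replacing the coefficients of T_n by their real parts and rescaling gives P
   with leading coefficient 2 / t_n and e contained in E, so that
   2 C(e)^n <= t_n, and equality forces e = E. Conversely, if e = Q^-1([-2,2])
   and Q has leading coefficient c, then t_n <= ||Q / c|| <= 2 / |c| <= 2 C(e)^n. *)

Set Implicit Arguments.
Unset Strict Implicit.
Unset Printing Implicit Defensive.

Local Open Scope classical_set_scope.
Local Open Scope ring_scope.
Local Open Scope complex_scope.

Local Notation normc := Normc.normc.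
Local Notation Re := complex.Re.
Local Notation Im := complex.Im.

(** * Vandermonde determinants in a basis of monic polynomials *)

Section Vandermonde.
Variable F : comNzRingType.

(** The matrix is the coefficient matrix of the [q i], triangular with unit diagonal, times the
    usual Vandermonde matrix, so the choice of the monic polynomials does not affect the
    determinant. *)
Lemma det_monic_Vandermonde (N : nat) (q : nat -> {poly F}) (x : 'I_N -> F) :
  (forall j, q j \is monic) -> (forall j, size (q j) = j.+1) ->
  \det (\matrix_(i < N, j < N) (q i).[x j]) =
  \prod_(i < N) \prod_(j < N | (i < j)%N) (x j - x i).
Proof.
move=> qm qs.
have -> : \matrix_(i < N, j < N) (q i).[x j] =
    (\matrix_(i < N, k < N) (q i)`_k) *m Vandermonde N (\row_j x j).
  apply/matrixP => i j; rewrite !mxE (@horner_coef_wide _ N) ?qs//.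
  by apply: eq_bigr => k _; rewrite !mxE.
rewrite det_mulmx det_Vandermonde det_trig.
  rewrite big1 ?mul1r => [|i _].
    by apply: eq_bigr => i _; apply: eq_bigr => j _; rewrite !mxE.
  by rewrite mxE; have /eqP := qm i; rewrite /lead_coef (qs i).
by apply/is_trig_mxP => i j ij; rewrite mxE nth_default// (qs i).
Qed.

End Vandermonde.

(** * Integration of discrete pair energies against a probability measure *)

Section PairEnergy.
Local Open Scope ereal_scope.
Context d (T : measurableType d) (R : realType).
Variables (mu : probability T R) (e : set T) (G : T * T -> \bar R).
Hypotheses (me : measurable e) (mue : mu e = 1).
Hypotheses (mG : measurable_fun setT G) (G0 : forall p, 0 <= G p).
Hypothesis symG : forall x y, G (x, y) = G (y, x).

Fixpoint pair_energy (s : seq T) : \bar R :=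
  if s is x :: s' then \sum_(y <- s') G (x, y) + pair_energy s' else 0.

Let U x := \int[mu]_y G (x, y).

Let mGl y : measurable_fun [set: T] (fun x => G (x, y)).
Proof. exact: measurableT_comp. Qed.

Let mU : measurable_fun [set: T] U.
Proof. exact: (measurable_fun_fubini_tonelli_F G). Qed.

Let U0 x : 0 <= U x.
Proof. exact: integral_ge0. Qed.

Let pair_energy_ge0 s : 0 <= pair_energy s.
Proof. by elim: s => //= x s IH; rewrite adde_ge0// sume_ge0. Qed.

Let le_prob_integral (m : R) (f : T -> \bar R) : (0 <= m)%R ->
  measurable_fun [set: T] f -> (forall x, 0 <= f x) ->
  (forall x, e x -> m%:E <= f x) -> m%:E <= \int[mu]_x f x.
Proof.
move=> m0 mf f0 mef.
have -> : m%:E = \int[mu]_(x in e) m%:E.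
  by rewrite integral_cst//= [X in _ * X](_ : _ = 1) ?mule1//; exact: mue.
apply: (@le_trans _ _ (\int[mu]_(x in e) f x)).
  by apply: ge0_le_integral => //; exact: measurable_funTS.
by apply: ge0_subset_integral.
Qed.

Let algr (a k u v g p : \bar R) : 0 <= u -> 0 <= v ->
  a + k * (u + v) + (g + p) = (a + k * v + p) + (k * u + g).
Proof.
move=> u0 v0; rewrite ge0_muleDr//.
by rewrite [LHS](+%R.[AC ((1*2)*2) (((1*3)*5)*(2*4))]).
Qed.

Let algl (a k : R) (i v p : \bar R) : (0 <= a)%R -> (0 <= k)%R ->
  (k + a)%:E * i + (k + 1)%:E * v + p =
  (a%:E * i + k%:E * v + p) + (k%:E * i + v).
Proof.
move=> a0 k0; rewrite !EFinD !ge0_muleDl ?lee_fin// mul1e.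
by rewrite [LHS](+%R.[AC ((2*2)*1) (((2*3)*5)*(1*4))]).
Qed.

(* Integrating k of the N points against mu leaves k-choose-2 copies of the energy,
   k times the potentials of the other points, and their pair energy. *)
Lemma le_pair_energy (m : R) (N : nat) : (0 <= m)%R ->
  (forall s, size s = N -> {in s, forall x, e x} -> m%:E <= pair_energy s) ->
  m%:E <= ('C(N, 2)%:R)%:E * \int[mu]_x \int[mu]_y G (x, y).
Proof.
move=> m0 H.
suff : forall k, (k <= N)%N -> forall s, size s = (N - k)%N ->
    {in s, forall x, e x} ->
    m%:E <= ('C(k, 2)%:R)%:E * \int[mu]_x U x +
      (k%:R)%:E * \sum_(y <- s) U y + pair_energy s.
  move=> /(_ N (leqnn _) [::]); rewrite subnn big_nil /= mule0 !adde0.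
  by apply.
elim=> [_ s|k IH kN s sN se].
  by rewrite subn0 bin0n !mul0e !add0e; exact: H.
have I0 : 0 <= \int[mu]_x U x by exact: integral_ge0.
have S0 : 0 <= \sum_(y <- s) U y by rewrite sume_ge0.
have mS : measurable_fun [set: T] (fun x => \sum_(y <- s) G (x, y)).
  exact: emeasurable_sum.
have mkU : measurable_fun [set: T] (fun x => (k%:R)%:E * U x).
  exact: measurable_funeM.
have kU0 x : 0 <= (k%:R)%:E * U x by rewrite mule_ge0// lee_fin.
have sG0 x : 0 <= \sum_(y <- s) G (x, y) by rewrite sume_ge0.
have intE (c : \bar R) : 0 <= c ->
  \int[mu]_x (c + ((k%:R)%:E * U x + \sum_(y <- s) G (x, y))) =
    c + ((k%:R)%:E * (\int[mu]_x U x) + \sum_(y <- s) U y).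
  move=> c0; rewrite (ge0_integralD mu measurableT) => //; last 2 first.
  - by move=> x _; exact: adde_ge0.
  - exact: emeasurable_funD.
  rewrite (ge0_integralD mu measurableT) => //.
  have -> : \int[mu]_x c = c.
    rewrite (integral_cst mu measurableT) -[RHS]mule1.
    by congr (_ * _); exact: probability_setT.
  rewrite (ge0_integralZl_EFin mu measurableT)//
    (ge0_integral_sum mu measurableT)//.
  congr (_ + (_ + _)); apply: eq_bigr => y _.
  by apply: eq_integral => x _; rewrite symG.
pose c := ('C(k, 2)%:R)%:E * \int[mu]_x U x + (k%:R)%:E * \sum_(y <- s) U y +
  pair_energy s.
have c0 : 0 <= c by rewrite /c !adde_ge0// mule_ge0// lee_fin.
(* For [x] in [e] the induction hypothesis applies to [x :: s]. Integrating it in [x] turns the k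
   potentials [U x] into k copies of the energy, and the pair terms [G (x, y)] into the potentials
   of the points of [s]. *)
have : m%:E <= \int[mu]_x (c + ((k%:R)%:E * U x + \sum_(y <- s) G (x, y))).
  apply: le_prob_integral => //.
  - by apply: emeasurable_funD => //; exact: emeasurable_funD.
  - by move=> x; apply: adde_ge0 => //; exact: adde_ge0.
  move=> x ex; have := IH (ltnW kN) (x :: s).
  rewrite big_cons /= sN => /(_ _ _)/le_trans; apply.
  - by rewrite -subSn// subSS.
  - by move=> y; rewrite inE => /orP[/eqP->//|]; exact: se.
  by rewrite algr.
rewrite intE// => /le_trans; apply; rewrite /c binS bin1 addnC natrD -natr1.
by rewrite algl.
Qed.

End PairEnergy.

(** * Modulus, topology and Borel sets of the complex plane *)

Section ComplexPlane.
Context {R : realType}.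
Implicit Types (z w : R[i]) (x : R).

Lemma normC_def z : `|z| = (normc z)%:C.
Proof. by case: z. Qed.

Lemma normc_real x : normc x%:C = `|x|.
Proof. by rewrite /= expr0n /= addr0 sqrtr_sqr. Qed.

Lemma normc_ge0 z : 0 <= normc z.
Proof. by case: z => a b; exact: sqrtr_ge0. Qed.

Lemma normc_sqr z : normc z ^+ 2 = Re z ^+ 2 + Im z ^+ 2.
Proof. by case: z => a b /=; rewrite sqr_sqrtr// addr_ge0 ?sqr_ge0. Qed.

Lemma normc_eq0 z : (normc z == 0) = (z == 0).
Proof.
by apply/eqP/eqP => [/Normc.eq0_normc //|->]; rewrite /= expr0n /= addr0 sqrtr0.
Qed.

Lemma normc_gt0 z : (0 < normc z) = (z != 0).
Proof. by rewrite lt_def normc_eq0 normc_ge0 andbT. Qed.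

Lemma normcX z k : normc (z ^+ k) = normc z ^+ k.
Proof.
elim: k => [|k IH]; first by rewrite !expr0 -[1]/(1%:C) normc_real normr1.
by rewrite !exprS Normc.normcM IH.
Qed.

Lemma normc_prod (I : Type) (s : seq I) (F : I -> R[i]) :
  normc (\prod_(i <- s) F i) = \prod_(i <- s) normc (F i).
Proof.
elim: s => [|i s IH]; first by rewrite !big_nil -[1]/(1%:C) normc_real normr1.
by rewrite !big_cons Normc.normcM IH.
Qed.

Lemma normc_sub z w : normc (z - w) = normc (w - z).
Proof. by rewrite -(normcN (z - w)) opprB. Qed.

Lemma le_normc_sum (I : Type) (s : seq I) (F : I -> R[i]) :
  normc (\sum_(i <- s) F i) <= \sum_(i <- s) normc (F i).
Proof.
elim: s => [|i s IH]; first by rewrite !big_nil -[0]/(0%:C) normc_real normr0.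
by rewrite !big_cons (le_trans (le_normcD _ _))// lerD2l.
Qed.

Lemma normc_ge_normRe z : `|Re z| <= normc z.
Proof. by have := normc_ge_Re z; rewrite normC_def lecR. Qed.

Lemma normc_ge_normIm z : `|Im z| <= normc z.
Proof.
by rewrite -ler_sqr ?nnegrE ?normc_ge0// normc_sqr real_normK ?num_real//
  lerDr sqr_ge0.
Qed.

Lemma ball_normc (z w : R[i]^o) (d : R) : ball z d%:C w <->
    normc ((z : R[i]) - w) < d.
Proof. by rewrite -ball_normE /ball_ /= normC_def ltcR. Qed.

Lemma open_normcP (A : set R[i]^o) :
  open A <-> forall z, A z -> exists2 d, 0 < d & forall w, normc (z - w) < d ->
    A w.
Proof.
rewrite openE; split => [oA z /oA/nbhs_ballP[[a b] /=]|H z /H[d d0 dA]].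
  (* Radii of balls are elements of [R[i]]; a positive one has imaginary part 0. *)
  rewrite ltcE /= => /andP[/eqP -> a0] aA; exists a => // w zw.
  by apply: aA; apply/ball_normc.
apply/nbhs_ballP; exists d%:C => /=; first by rewrite ltcR.
by move=> w /ball_normc; exact: dA.
Qed.

Lemma open_preimage_lip (f : R[i]^o -> R) (A : set R) :
  (forall z w, `|f z - f w| <= normc ((z : R[i]) - w)) -> open A ->
  open (f @^-1` A).
Proof.
move=> lf; rewrite openE => oA;
  apply/open_normcP => z /oA /nbhs_ballP[d /= d0 dA].
by exists d => // w zw; apply: dA;
  rewrite -ball_normE /ball_ /= (le_lt_trans (lf z w)).
Qed.

Lemma measurable_lip (f : borelC R -> R) :
  (forall z w : R[i], `|f z - f w| <= normc (z - w)) -> measurable_fun setT f.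
Proof.
move=> lf; apply: (measurability _ (RGenOpens.measurableE R)) =>
  _ [_ [a [b ->]] <-].
by rewrite setTI; apply: sub_sigma_algebra; apply: open_preimage_lip => //;
  exact: interval_open.
Qed.

Lemma measurable_Re : measurable_fun setT (@Re R : borelC R -> R).
Proof. by apply: measurable_lip => -[a b] [c d];
  have := normc_ge_normRe ((a - c) +i* (b - d)). Qed.

Lemma measurable_Im : measurable_fun setT (@Im R : borelC R -> R).
Proof. by apply: measurable_lip => -[a b] [c d];
  have := normc_ge_normIm ((a - c) +i* (b - d)). Qed.

Lemma measurable_complex : measurable_fun setT (real_complex R : R -> borelC R).
Proof.
apply: (@measurability _ _ _ (borelC R) setT _ (@open R[i]^o)); first by [].
move=> _ [A oA <-]; rewrite setTI.
apply: open_measurable; rewrite openE => x Ax.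
have [d d0 dA] := (open_normcP A).1 oA _ Ax.
apply/nbhs_ballP; exists d => // y; rewrite -ball_normE /ball_ /= => xy.
by apply: dA; rewrite -rmorphB normc_real.
Qed.

Lemma closed_measurableC (A : set R[i]^o) : closed A ->
    measurable (A : set (borelC R)).
Proof.
move=> /closed_openC oA; rewrite -(setCK A); apply: measurableC.
exact: sub_sigma_algebra.
Qed.

Lemma compact_closedC (A : set R[i]^o) : compact A -> closed A.
Proof. by apply: compact_closed; exact: norm_hausdorff. Qed.

Lemma compact_boundedC (A : set R[i]^o) : compact A ->
  exists2 B : R, 1 <= B & forall z, A z -> normc z <= B.
Proof.
rewrite compact_cover => Aco.
have [||D _ DA] := Aco nat setT (fun n => [set z : R[i]^o | normc z < n%:R]).
- move=> n _; apply/open_normcP => z /= zn; exists (n%:R - normc z);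
  first by rewrite subr_gt0.
  move=> w; rewrite normc_sub ltrBrDr => h; apply: le_lt_trans h.
  by have := le_normcD (w - z) z; rewrite subrK.
- by move=> z _; exists (Num.truncn (normc z)).+1 => //=; rewrite truncnS_gt.
(* The sum of the radii of a finite subcover replaces their maximum; the summand 1 makes [ln B]
   nonnegative later. *)
exists (1 + \sum_(i <- finmap.enum_fset D) i%:R) => [|z /DA[i /= iD /ltW zi]].
  by rewrite lerDl sumr_ge0.
by apply: (le_trans zi); rewrite (big_rem i)//= addrCA lerDl addr_ge0//
  sumr_ge0.
Qed.

Lemma closed_dist (A : set R[i]^o) z : closed A -> ~ A z ->
  exists2 d : R, 0 < d & forall w, A w -> d <= normc (w - z).
Proof.
move=> /closed_openC/open_normcP oA /oA[d d0 dA]; exists d => // w Aw.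
by rewrite leNgt; apply/negP; rewrite normc_sub => /dA.
Qed.

End ComplexPlane.

(** * The logarithmic kernel, its nonnegative shift, and the energy *)

Section LogKernel.
Context {R : realType}.
Local Open Scope ereal_scope.

Definition logker (p : borelC R * borelC R) : \bar R :=
  - lne (normc ((p.1 : R[i]) - p.2))%:E.

Lemma logkerC z w : logker (z, w) = logker (w, z).
Proof. by rewrite /logker /= normc_sub. Qed.

Lemma measurable_normcB :
  measurable_fun setT (fun p : borelC R * borelC R =>
    normc ((p.1 : R[i]) - p.2)%R).
Proof.
rewrite (_ : (fun _ => _) = (fun p : borelC R * borelC R =>
  Num.sqrt ((Re (p.1 : R[i]) - Re (p.2 : R[i])) ^+ 2 +
            (Im (p.1 : R[i]) - Im (p.2 : R[i])) ^+ 2))%R); last first.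
  by apply/funext => -[[a b] [c d]].
apply: (@measurableT_comp _ _ _ _ _ _ (@Num.sqrt R)).
  by apply: continuous_measurable_fun; exact: sqrt_continuous.
apply: measurable_funD; apply: measurable_funX; apply: measurable_funB.
- exact: (measurableT_comp measurable_Re).
- exact: (measurableT_comp measurable_Re).
- exact: (measurableT_comp measurable_Im).
- exact: (measurableT_comp measurable_Im).
Qed.

Lemma measurable_logker : measurable_fun setT logker.
Proof.
apply: (@measurableT_comp _ _ _ _ _ _ (@oppe R)); first exact: oppe_measurable.
rewrite /lne /=; apply: measurable_fun_ifT.
- by apply: measurable_fun_ler => //; exact: measurable_normcB.
- exact: measurable_cst.
- by apply/measurable_EFinP; apply: measurableT_comp measurable_normcB.
Qed.

Variables (e : set (borelC R)) (B : R).
Hypotheses (me : measurable e) (B1 : (1 <= B)%R).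
Hypothesis eB : forall z : R[i], e z -> (normc z <= B)%R.

(* Shifted so that it is nonnegative, without truncation on e * e, whose points are
   at distance at most 2 B: this gives access to Tonelli's theorem. *)
Definition nnlogker (p : borelC R * borelC R) : \bar R :=
  maxe (logker p + (ln (2 * B))%:E) 0.

Lemma nnlogker_ge0 p : 0 <= nnlogker p.
Proof. by rewrite le_max lexx orbT. Qed.

Lemma nnlogkerC z w : nnlogker (z, w) = nnlogker (w, z).
Proof. by rewrite /nnlogker logkerC. Qed.

Lemma measurable_nnlogker : measurable_fun setT nnlogker.
Proof.
apply: measurable_maxe => //; apply: emeasurable_funD => //.
exact: measurable_logker.
Qed.

Let B2 : (0 < 2 * B)%R.
Proof. by rewrite mulr_gt0// (lt_le_trans _ B1). Qed.

Lemma nnlogkerE z w : e z -> e w ->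
  nnlogker (z, w) = logker (z, w) + (ln (2 * B))%:E.
Proof.
move=> /eB zB /eB wB; apply/max_idPl; rewrite /logker /=; case: ifPn => [_|];
  first by rewrite leey.
rewrite -ltNge => n0; rewrite -EFinN -EFinD lee_fin addrC subr_ge0 ler_ln//.
by rewrite (le_trans (le_normcD _ _))// normcN mulr_natl mulr2n lerD.
Qed.

Lemma logker_nnlogker z w : e z -> e w ->
  logker (z, w) = nnlogker (z, w) - (ln (2 * B))%:E.
Proof. by move=> ez ew; rewrite nnlogkerE// addeK. Qed.

(** The integral of [f] may be infinite, so linearity for integrable functions does not apply. The
    negative part of [g = f - c] is at most c, hence integrable, and the identity
    [f + g^- = g^+ + c] involves nonnegative functions only. *)
Lemma integralB_prob d (T : measurableType d) (mu : probability T R)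
    (f : T -> \bar R) (c : R) :
  measurable_fun setT f -> (forall x, 0 <= f x) -> (0 <= c)%R ->
  \int[mu]_x (f x - c%:E) = \int[mu]_x f x - c%:E.
Proof.
move=> mf f0 c0; pose g x := f x - c%:E.
have mg : measurable_fun setT g.
  by apply: emeasurable_funB => //.
have gn x : g^\- x <= c%:E.
  rewrite funenegE ge_max lee_fin c0 andbT /g.
  case: (f x) (f0 x) => [r| |]//=; rewrite ?leNye// !lee_fin => r0.
  by rewrite opprB gerBl.
have intc : \int[mu]_x c%:E = c%:E.
  by rewrite integral_cst//= -[RHS]mule1; congr (_ * _);
    exact: probability_setT.
have gnE : \int[mu]_x g^\- x \is a fin_num.
  rewrite ge0_fin_numE ?integral_ge0//;
    apply: (@le_lt_trans _ _ (\int[mu]_x c%:E)).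
    by apply: ge0_le_integral => //; exact: measurable_funeneg.
  by rewrite intc ltry.
have : \int[mu]_x (f x + g^\- x) = \int[mu]_x (g^\+ x + c%:E).
  apply: eq_integral => x _; rewrite funeposE funenegE /g.
  case: (f x) (f0 x) => [r r0| |]//=; last by rewrite max_r.
  have [h|h] := leP 0%R (r - c)%R.
    rewrite max_r ?max_l ?lee_fin// ?oppr_le0//.
    by rewrite -!EFinD subrK addr0.
  rewrite max_l ?max_r ?lee_fin// ?oppr_ge0// ?ltW//.
  by rewrite -!EFinD opprB addrC subrK add0r.
rewrite (ge0_integralD mu measurableT)//; last exact: measurable_funeneg.
rewrite [X in _ = X -> _](ge0_integralD mu measurableT)//;
  last exact: measurable_funepos.
rewrite intc => E; rewrite -[LHS]/(\int[mu]_x g x) integralE.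
rewrite -[\int[mu]_x f x](addeK _ gnE) E.
by rewrite [X in _ = X]addeAC addeK.
Qed.

(** The complement of [e] is a null set, and on [e] the shift is exact, so both the inner and the
    outer integrands agree almost everywhere. *)
Lemma log_energyE (mu : probability (borelC R) R) : mu e = 1 ->
  log_energy mu = \int[mu]_z \int[mu]_w nnlogker (z, w) - (ln (2 * B))%:E.
Proof.
move=> mue; set c := ln (2 * B).
have c0 : (0 <= c)%R by rewrite ln_ge0// (le_trans B1)// ler_peMl ?ler1n//
  (le_trans _ B1).
have mue0 : mu (~` e) = 0.
  by rewrite probability_setC// [X in _ - X](_ : _ = 1) ?subee.
have aeE (f g : borelC R -> \bar R) : (forall z, e z -> f z = g z) ->
  ae_eq mu setT f g.
  move=> fg; exists (~` e); split => //; first exact: measurableC.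
  by move=> z /= H /fg ez; apply: H => _.
have mU : measurable_fun setT (fun z => \int[mu]_w nnlogker (z, w)).
  apply: (measurable_fun_fubini_tonelli_F nnlogker).
    exact: measurable_nnlogker.
  exact: nnlogker_ge0.
have mlr z : measurable_fun setT (fun w => logker (z, w)).
  by apply: measurableT_comp => //; exact: measurable_logker.
have mlr' z : measurable_fun setT (fun w => nnlogker (z, w)).
  by apply: measurableT_comp => //; exact: measurable_nnlogker.
(* The kernel has no constant sign, so Tonelli is applied to its positive and negative parts
   separately. *)
have mI : measurable_fun setT (fun z => \int[mu]_w logker (z, w)).
  have mlk := measurable_logker.
  have mp := measurable_fun_fubini_tonelli_F (m2 := mu) (logker^\+)
    (measurable_funepos mlk) (funepos_ge0 _).
  have mn := measurable_fun_fubini_tonelli_F (m2 := mu) (logker^\-)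
    (measurable_funeneg mlk) (funeneg_ge0 _).
  apply: eq_measurable_fun (emeasurable_funB mp mn) => z _.
  rewrite [RHS]integralE; congr (_ - _); apply: eq_integral => w _.
    by rewrite !funeposE.
  by rewrite !funenegE.
rewrite -integralB_prob//; last by move=> z; apply: integral_ge0 => w _;
  exact: nnlogker_ge0.
rewrite /log_energy; apply: ae_eq_integral => //.
  exact: emeasurable_funB.
apply: (aeE _ _) => z ez.
rewrite -integralB_prob//; last by move=> w; exact: nnlogker_ge0.
apply: ae_eq_integral => //; [exact: mlr|exact: emeasurable_funB|].
by apply: aeE => w ew; exact: logker_nnlogker.
Qed.

End LogKernel.

(** * Products of mutual distances and their logarithms *)

Section Fekete.
Context {R : realType}.

Fixpoint pair_prod (s : seq R[i]) : R :=
  if s is x :: s' then (\prod_(y <- s') normc (x - y)) * pair_prod s' else 1.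

Lemma pair_prod_ge0 s : 0 <= pair_prod s.
Proof. by elim: s => //= x s IH; rewrite mulr_ge0// prodr_ge0// => y _;
  exact: normc_ge0. Qed.

Lemma pair_prodE s : pair_prod s = \prod_(i < size s) \prod_(j < size s | (i <
    j)%N)
   normc (s`_j - s`_i).
Proof.
elim: s => [|x s IH]; first by rewrite big_ord0.
rewrite /= big_ord_recl /= IH; congr (_ * _).
  rewrite [RHS]big_mkcond [RHS]big_ord_recl /= mul1r (big_nth 0) big_mkord.
  by apply: eq_bigr => i _; rewrite normc_sub.
apply: eq_bigr => i _; rewrite [RHS]big_mkcond big_ord_recl /= mul1r.
by rewrite big_mkcond.
Qed.

Local Open Scope ereal_scope.

(** Vanishing factors are allowed: both sides are then +oo, as [- lne] never takes the value -oo on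
    real arguments. *)
Lemma nlneM (a b : R) : (0 <= a)%R -> (0 <= b)%R ->
  - lne (a * b)%:E = - lne a%:E + - lne b%:E.
Proof.
rewrite !le_eqVlt => /predU1P[<-|a0] /predU1P[<-|b0];
  rewrite ?mul0r ?mulr0 /= ?lexx//.
- by case: ifPn.
- by case: ifPn.
rewrite !ifF; try by apply/negbTE; rewrite -ltNge ?mulr_gt0.
by rewrite lnM// -!EFinN -EFinD opprD.
Qed.

Lemma nlne_prod (I : Type) (s : seq I) (F : I -> R) :
  (forall i, 0 <= F i)%R ->
  - lne (\prod_(i <- s) F i)%R%:E = \sum_(i <- s) - lne (F i)%:E.
Proof.
move=> F0; elim: s => [|i s IH]; first by rewrite !big_nil lne1 oppe0.
by rewrite !big_cons nlneM ?IH// prodr_ge0.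
Qed.

Lemma le_nlne (a b : R) : (a <= expR b)%R -> (- b)%:E <= - lne a%:E.
Proof.
move=> ab /=; case: ifPn => [_|]; first by rewrite leey.
rewrite -ltNge => a0; rewrite -EFinN lee_fin lerN2.
by rewrite -(expRK b) ler_ln// posrE expR_gt0.
Qed.

(** For points of [e] the truncation is inactive, and every pair contributes the shift [ln (2 * B)]
    once. *)
Lemma pair_energy_nnlogker (e : set (borelC R)) (B : R) (s : seq (borelC R)) :
  (1 <= B)%R -> (forall z : R[i], e z -> (normc z <= B)%R) ->
  {in s, forall x, e x} ->
  pair_energy (nnlogker B) s =
    - lne (pair_prod s)%:E + ('C(size s, 2)%:R * ln (2 * B))%:E.
Proof.
move=> B1 eB; elim: s => [_|x s IH se].
  by rewrite bin0n mul0r lne1 oppe0 adde0.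
rewrite [size _]/= [pair_prod _]/= [LHS]/=.
rewrite IH => [|y ys]; last by apply: se; rewrite inE ys orbT.
rewrite binS bin1 natrD [(_ * ln (2 * B))%R in RHS]mulrDl [in RHS]EFinD.
have -> : \sum_(y <- s) nnlogker B (x, y) =
    - lne (\prod_(y <- s) normc ((x : R[i]) - y))%:E + ((size s)%:R * ln (2 *
      B))%:E.
  rewrite nlne_prod => [|y]; last exact: normc_ge0.
  have -> : ((size s)%:R * ln (2 * B))%:E = \sum_(y <- s) (ln (2 * B))%:E.
    by rewrite sumEFin big_const_seq count_predT iter_addr_0 mulr_natl.
  rewrite -big_split /=; apply: eq_big_seq => y ys.
  rewrite (nnlogkerE B1 eB) //; apply: se; rewrite inE ?eqxx// ys orbT//.
rewrite nlneM ?pair_prod_ge0//; last by rewrite prodr_ge0// => y _;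
  exact: normc_ge0.
by rewrite [LHS](+%R.[AC (2*2) ((1*3)*(4*2))]).
Qed.

End Fekete.

(** * Upper bounds for products of mutual distances *)

Section FeketeBound.
Context {R : realType}.

(** The product is the modulus of a Vandermonde determinant. Each of the N! terms of its Leibniz
    expansion takes one entry from every row, and the entries of row j are at most [b j]. *)
Lemma ler_pair_prod (q : nat -> {poly R[i]}) (b : nat -> R) (s : seq R[i]) :
  (forall j, q j \is monic) -> (forall j, size (q j) = j.+1) ->
  (forall j, {in s, forall x, normc (q j).[x] <= b j}) ->
  pair_prod s <= (size s)`!%:R * \prod_(j < size s) b j.
Proof.
move=> qm qs qb.
have -> : pair_prod s = normc (\det (\matrix_(i < size s, j < size s) (q
  i).[s`_j])).
  rewrite det_monic_Vandermonde// normc_prod pair_prodE.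
  by apply: eq_bigr => i _; rewrite big_mkcond [in RHS]big_mkcond normc_prod;
    apply: eq_bigr => j _; case: ifP => // _; rewrite Normc.normc1.
rewrite /determinant (le_trans (le_normc_sum _ _))//.
apply: (@le_trans _ _ (\sum_(sg : 'S_(size s)) \prod_(j < size s) b j));
  last first.
  by rewrite sumr_const card_Sn mulr_natl.
apply: ler_sum => sg _; rewrite Normc.normcM normcX normcN.
rewrite Normc.normc1 expr1n mul1r normc_prod ler_prod// => i _.
by rewrite mxE normc_ge0 qb// mem_nth.
Qed.

(** A crude bound suffices: the logarithm of N! only has to be small compared with the number of
    pairs. *)
Lemma fact_le_expn N : (N`! <= N ^ N)%N.
Proof.
elim: N => // N IH; rewrite factS expnS leq_mul2l /= (leq_trans IH)//.
by case: N {IH} => // N; rewrite leq_exp2r.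
Qed.

(** For y < 0 the products would tend to -oo. This form replaces a passage to the limit. *)
Lemma real_limit_ge0 (y K : R) : (forall m : nat, (0 < m)%N -> - K <=
    y * m%:R) -> 0 <= y.
Proof.
move=> H; rewrite leNgt; apply/negP => y0.
have := H (Num.truncn (K / - y)).+1 isT; rewrite leNgt => /negP; apply.
have : K / - y < (Num.truncn (K / - y)).+1%:R by exact: truncnS_gt.
by rewrite ltr_pdivrMr ?oppr_gt0// mulrN ltrNr mulrC.
Qed.

(** A monic family with one member in each degree j, of size M^(j/k) up to a factor that does not
    depend on j: [|ln M|] pays for rounding j/k down, [k * ln B] for the leftover power of X. *)
Lemma monic_bound (Q : {poly R[i]}) (k j : nat) (M B : R) (z : R[i]) :
  (0 < k)%N -> 0 < M -> 1 <= B -> normc z <= B -> normc Q.[z] <= M ->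
  normc (Q ^+ (j %/ k) * 'X^(j %% k)).[z] <=
    expR (j%:R * (ln M / k%:R) + (`|ln M| + k%:R * ln B)).
Proof.
move=> k0 M0 B1 zB QM; have B0 : 0 < B by rewrite (lt_le_trans _ B1).
rewrite hornerM horner_exp hornerXn Normc.normcM !normcX.
apply: (@le_trans _ _ (M ^+ (j %/ k) * B ^+ (j %% k))).
  by rewrite ler_pM ?exprn_ge0 ?normc_ge0// lerXn2r ?nnegrE ?normc_ge0// ltW.
have kR : 0 < k%:R :> R by rewrite ltr0n.
rewrite -{1}(lnK M0) -{1}(lnK B0) -!expRM_natl -expRD ler_expR.
have -> : j%:R = (j %/ k)%:R * k%:R + (j %% k)%:R :> R.
  by rewrite -natrM -natrD -divn_eq.
have lnB : 0 <= ln B by rewrite ln_ge0.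
have jk : (j %% k)%:R <= k%:R :> R by rewrite ler_nat ltnW// ltn_mod.
set f := (j %/ k)%:R; set r := (j %% k)%:R in jk *.
have r1 : 0 <= r / k%:R <= 1.
  by rewrite divr_ge0 ?ler0n//= ler_pdivrMr// mul1r.
have : `|ln M * (r / k%:R)| <= `|ln M|.
  by rewrite normrM ler_piMr// ger0_norm; case/andP: r1.
rewrite ler_norml => /andP[h _].
have -> : (f * k%:R + r) * (ln M / k%:R) = f * ln M + ln M * (r / k%:R).
  by field; rewrite gt_eqF.
have : r * ln B <= k%:R * ln B by rewrite ler_wpM2r.
lra.
Qed.

End FeketeBound.

(** * Lower bound for the energy from a monic polynomial bounded on the set *)

Section EnergyBound.
Context {R : realType}.

(** Any N points of [e] have a distance product of at most N^N exp('C(N, 2) a + N K) with a = ln M /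
    k. Integrating the logarithms and dividing by the number of pairs gives the bound up to an error
    of order ln N / N. *)
Lemma log_energy_ge (e : set R[i]^o) (Q : {poly R[i]}) (k : nat) (M : R)
    (mu : probability (borelC R) R) :
  compact e -> (0 < k)%N -> Q \is monic -> size Q = k.+1 -> 0 < M ->
  (forall z : R[i], e z -> normc Q.[z] <= M) -> mu (e : set (borelC R)) = 1%E ->
  ((- (ln M / k%:R))%:E <= log_energy mu)%E.
Proof.
move=> ce k0 Qm Qs M0 QM mue.
have [B B1 eB] := compact_boundedC ce.
have me := closed_measurableC (compact_closedC ce).
rewrite (log_energyE me B1 eB mue).
set J := (\int[mu]_z _)%E; set c := ln (2 * B).
pose q j := Q ^+ (j %/ k) * 'X^(j %% k).
have qm j : q j \is monic by rewrite /q monicMr ?monicXn ?monic_exp.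
have qs j : size (q j) = j.+1.
  rewrite /q (size_monicM (monic_exp _ Qm)) ?monic_neq0 ?monicXn//.
 rewrite size_polyXn addnS /=.
  rewrite -(prednK (_ : 0 < size (Q ^+ _))%N) ?size_poly_gt0 ?monic_neq0
    ?monic_exp//.
  by rewrite size_exp Qs /= addSn mulnC -divn_eq.
pose a := ln M / k%:R; pose K := `|ln M| + k%:R * ln B.
have K0 : 0 <= K by rewrite addr_ge0// mulr_ge0// ln_ge0.
have J0 : (0 <= J)%E.
  by apply: integral_ge0 => z _; apply: integral_ge0 => w _;
    exact: nnlogker_ge0.
have H N : (1 < N)%N ->
    ((('C(N, 2)%:R * (c - a) - N%:R * (ln N%:R + K))%:E <=
      'C(N, 2)%:R%:E * J)%E).
  move=> N1; set m := (X in (X%:E <= _)%E).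
  (* [le_pair_energy] asks for a nonnegative bound; a negative one is trivial here because [J] is
     nonnegative. *)
  have [m0|/ltW m0] := leP 0 m; last first.
    by rewrite (@le_trans _ _ 0%E) ?lee_fin// mule_ge0// lee_fin.
  apply: (@le_pair_energy _ _ R mu e) => //.
  - exact: measurable_nnlogker.
  - exact: nnlogker_ge0.
  - exact: nnlogkerC.
  move=> s sN se; rewrite (pair_energy_nnlogker B1 eB)// sN.
  have sq j : {in s, forall x, normc (q j).[x] <= expR (j%:R * a + K)}.
    by move=> x /se ex; apply: monic_bound => //; [exact: eB|exact: QM].
  have := ler_pair_prod qm qs sq; rewrite sN -expR_sum => Hp.
  have : pair_prod s <= expR (N%:R * ln N%:R + ('C(N, 2)%:R * a + N%:R * K)).
    apply: (le_trans Hp); rewrite expRD ler_pM// ?expR_ge0//.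
      rewrite mulrC expRM_natr lnK ?posrE ?ltr0n ?(ltnW N1)//.
      by rewrite -natrX ler_nat fact_le_expn.
    rewrite ler_expR big_split /= -mulr_suml sumr_const card_ord [N%:R *
      K]mulr_natl.
    by rewrite -natr_sum -bin2_sum big_mkord.
  move/le_nlne => Hn; apply: (le_trans _ (leeD Hn (lexx _))).
  by rewrite -EFinD lee_fin /m /c; lra.
move: J J0 H => [J| |]// J0 H; last by rewrite leey.
rewrite -EFinB lee_fin -subr_ge0 opprK.
(* Take N = m^2 + 1 points, so that ln N <= 2 m. Dividing the inequality by N m / 2 leaves an error
   of at most 2 (ln N + K) / m <= 4 + 2 K. *)
apply: (@real_limit_ge0 _ _ (4 + 2 * K)) => m m0.
have m0R : 0 < m%:R :> R by rewrite ltr0n.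
have N1 : (1 < (m ^ 2).+1)%N by rewrite ltnS expn_gt0 m0.
have := H _ N1; rewrite -EFinM lee_fin => {}H.
have binE : 'C((m ^ 2).+1, 2)%:R = (m%:R ^+ 2 + 1) * m%:R ^+ 2 / 2 :> R.
  apply: (mulIf (_ : 2%:R != 0)); rewrite ?pnatr_eq0// divfK ?pnatr_eq0//.
  by rewrite -natrM muln2 -mul2n -mul_bin_diag /= bin1 natrM -natr1 natrX.
have lnE : ln (m ^ 2).+1%:R <= 2 * m%:R :> R.
  apply: (@le_trans _ _ (ln ((1 + m%:R) ^+ 2))).
    rewrite ler_ln ?posrE ?ltr0n// ?exprn_gt0 ?addr_gt0//.
    by rewrite -natr1 natrX; nra.
  by rewrite lnXn ?addr_gt0// -[leLHS]mulr_natl ler_pM2l// le_ln1Dx//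
    (lt_trans _ m0R)// ltrN10.
have m1 : 1 <= m%:R :> R by rewrite ler1n.
have sE : (m ^ 2).+1%:R = m%:R ^+ 2 + 1 :> R by rewrite -natr1 natrX.
rewrite sE in lnE; rewrite binE sE in H.
set x := m%:R in m0R m1 lnE H *.
set l := ln _ in lnE H.
rewrite -/a -/c.
have p0 : 0 < (x ^+ 2 + 1) by rewrite addr_gt0// exprn_gt0.
have {}H : - (l + K) <= (J - c + a) * x ^+ 2 / 2.
  rewrite -(ler_pM2l p0); move: H; rewrite -subr_ge0 => H; rewrite -subr_ge0.
  by apply: (le_trans H); rewrite le_eqVlt; apply/orP; left; apply/eqP; field.
rewrite -(ler_pM2r m0R).
nra.
Qed.

End EnergyBound.

(** * Upper bounds for the capacity and iterates of w^2 - 2 *)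

Section Capacity.
Context {R : realType}.
Implicit Types (e : set R[i]^o) (P Q : {poly R[i]}).

Lemma robin_ge e Q k M :
  compact e -> (0 < k)%N -> Q \is monic -> size Q = k.+1 -> 0 < M ->
  (forall z : R[i], e z -> normc Q.[z] <= M) ->
  ((- (ln M / k%:R))%:E <= robin e)%E.
Proof.
move=> ce k0 Qm Qs M0 QM; apply: le_ereal_inf_tmp => _ [mu /= mue <-].
exact: (log_energy_ge ce k0 Qm Qs M0 QM mue).
Qed.

Lemma capacity_ge0 e : 0 <= capacity e.
Proof. by rewrite /capacity fine_ge0// expeR_ge0. Qed.

Lemma capacity_le e Q k M :
  compact e -> (0 < k)%N -> Q \is monic -> size Q = k.+1 -> 0 < M ->
  (forall z : R[i], e z -> normc Q.[z] <= M) ->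
  capacity e ^+ k <= M.
Proof.
move=> ce k0 Qm Qs M0 QM; have := robin_ge ce k0 Qm Qs M0 QM.
(* The lower bound excludes -oo, and for +oo the capacity is 0. *)
rewrite /capacity; case: (robin e) => [r| |] //=; last first.
  by move=> _; rewrite expr0n gtn_eqF// ltW.
rewrite lee_fin => h.
rewrite -expRM_natl -[leRHS](lnK M0) ler_expR.
by move: h; rewrite lerNl ler_pdivlMr ?ltr0n// mulrC.
Qed.

(** Energies arbitrarily close to ln c / k bound the Robin constant from above. The value -oo has to
    be excluded because [fine] sends +oo to 0. *)
Lemma capacity_ge e k c : (0 < k)%N -> 0 < c -> (-oo < robin e)%E ->
  (forall d, 0 < d -> exists2 mu : probability (borelC R) R,
     mu (e : set (borelC R)) = 1%E & (log_energy mu <=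
       (ln c / k%:R + d)%:E)%E) ->
  c^-1 <= capacity e ^+ k.
Proof.
move=> k0 c0 roo H.
have : (robin e <= (ln c / k%:R)%:E)%E.
  apply/lee_addgt0Pr => d d0; have [mu mue] := H d d0.
  by rewrite EFinD; apply: le_trans; apply: ereal_inf_lbound; exists mu.
move: roo; rewrite /capacity; case: (robin e) => [r _| |] //=.
rewrite lee_fin => h.
rewrite -expRM_natl -[leLHS](lnK (_ : _^-1 \in Num.pos)) ?posrE ?invr_gt0//
  ler_expR.
by rewrite lnV// mulrN lerN2 mulrC -ler_pdivlMr ?ltr0n.
Qed.

Definition stdint : set R[i] := [set x%:C | x in `[(-2 : R), 2]].

Lemma normc_stdint w : stdint w -> normc w <= 2.
Proof. by move=> [x /= /[!in_itv]/= xI <-]; rewrite normc_real ler_norml. Qed.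

(** The square roots of the points of [0, 4] fill exactly [-2, 2]. For w = a + ib, a real square
    gives a b = 0, and a = 0 would make the square -b^2, which is nonnegative only for b = 0. *)
Lemma stdint_sqr w : stdint (w ^+ 2 - 2) <-> stdint w.
Proof.
split=> [|[x /= /[!in_itv]/= /andP[x2 x2'] <-]]; last first.
  exists (x ^+ 2 - 2); last by rewrite rmorphB rmorphXn rmorph_nat.
  by rewrite /= in_itv/=; apply/andP; split; nra.
case: w => a b [x /= /[!in_itv]/= /andP[x2 x2']] /eqP.
rewrite eq_complex /= !(addr0, add0r, oppr0, subr0) => /andP[/eqP xE /eqP ab].
have b0 : b = 0.
  apply/eqP; rewrite -sqrf_eq0; apply/eqP.
  have [a0|b0] : a = 0 \/ b = 0.
    have /eqP : a * b = 0 by lra.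
    by rewrite mulf_eq0 => /orP[]/eqP; tauto.
  - by have := sqr_ge0 b; rewrite a0 in xE; nra.
  - by rewrite b0 expr0n.
exists a; last by rewrite b0.
by rewrite /= in_itv/= b0 in xE *; apply/andP; split; nra.
Qed.

Definition iter_sqr k P := iter k (fun q => q ^+ 2 - 2%:P) P.

Lemma horner_iter_sqr k P z :
  (iter_sqr k P).[z] = iter k (fun w => w ^+ 2 - 2) P.[z].
Proof. by elim: k => //= k IH; rewrite hornerD horner_exp hornerN hornerC IH.
  Qed.

Lemma iter_sqr_stdint k P z : stdint (iter_sqr k P).[z] <-> stdint P.[z].
Proof.
rewrite horner_iter_sqr; elim: k => //= k IH.
exact: iff_trans (stdint_sqr _) IH.
Qed.

Lemma size_lead_iter_sqr k P n : (0 < n)%N -> size P = n.+1 ->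
  size (iter_sqr k P) = (n * 2 ^ k).+1 /\
  lead_coef (iter_sqr k P) = lead_coef P ^+ (2 ^ k).
Proof.
move=> n0 Ps; elim: k => [|k [IHs IHl]]; first by rewrite muln1 expr1.
have q0 : iter_sqr k P != 0 by rewrite -size_poly_gt0 IHs.
have s2 : size (iter_sqr k P ^+ 2) = (n * 2 ^ k.+1).+1.
  rewrite -(prednK (_ : 0 < size (iter_sqr k P ^+ 2))%N) ?size_poly_gt0
    ?expf_neq0//.
  by rewrite size_exp IHs /= expnSr mulnA.
have lt2 : (size (- (2%:P : {poly R[i]}))%R < size (iter_sqr k P ^+ 2))%N.
  rewrite size_polyN (leq_ltn_trans (size_polyC_leq1 _))// s2 ltnS muln_gt0 n0.
  by rewrite expn_gt0.
split; first by rewrite /= size_polyDl.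
by rewrite /= lead_coefDl// lead_coef_exp IHl -exprM expnSr.
Qed.

(** By Bernoulli's inequality the powers of y > 1 are unbounded. This is what removes the factor 2
    as the number of iterations grows. *)
Lemma expr_pow2_le (y : R) : 0 <= y -> (forall k, y ^+ (2 ^ k) <= 2) -> y <= 1.
Proof.
move=> y0 H; rewrite leNgt; apply/negP => y1.
have bern m : 1 + m%:R * (y - 1) <= y ^+ m.
  elim: m => [|m IH]; first by rewrite mul0r addr0 expr0.
  rewrite exprS -natr1; have := @ler_wpM2l _ y y0 _ _ IH.
  have := mulr_ge0 (ler0n R m) (sqr_ge0 (y - 1)); nra.
(* Then 2^(m+1) >= m + 1 > 1 / (y - 1), so the Bernoulli bound exceeds 2. *)
pose m := Num.truncn (y - 1)^-1.
have : (y - 1)^-1 < m.+1%:R by exact: truncnS_gt.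
rewrite -div1r ltr_pdivrMr ?subr_gt0// => hm.
have := H m.+1; rewrite leNgt => /negP; apply; apply: lt_le_trans (bern _).
have : m.+1%:R <= (2 ^ m.+1)%:R :> R by rewrite ler_nat ltnW// ltn_expl.
by move=> h; have := @ler_wpM2r _ (y - 1) _ _ _ h;
  rewrite subr_ge0 ltW// => /(_ isT); lra.
Qed.

Lemma monic_scale P n : size P = n.+1 ->
  (lead_coef P)^-1 *: P \is monic /\ size ((lead_coef P)^-1 *: P) = n.+1.
Proof.
move=> Ps; have l0 : lead_coef P != 0 by rewrite lead_coef_eq0 -size_poly_gt0
  Ps.
by rewrite monicE lead_coefZ mulVf// size_scale ?invr_eq0.
Qed.

(** For y = C(e)^n c, the rescaled k-th iterate gives y^(2^k) <= 2 for every k, hence y <= 1. *)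
Lemma capacity_le_lead e P n : compact e -> (0 < n)%N -> size P = n.+1 ->
  (forall z : R[i], e z -> stdint P.[z]) ->
  capacity e ^+ n <= (normc (lead_coef P))^-1.
Proof.
move=> ce n0 Ps eP; set c := normc _.
have c0 : 0 < c by rewrite normc_gt0 lead_coef_eq0 -size_poly_gt0 Ps.
rewrite -[leRHS]mul1r ler_pdivlMr//.
apply: expr_pow2_le => [|k]; first by rewrite mulr_ge0 ?exprn_ge0 ?capacity_ge0
  ?ltW.
have [Fs Fl] := size_lead_iter_sqr k n0 Ps; have [Qm Qs] := monic_scale Fs.
have nk0 : (0 < n * 2 ^ k)%N by rewrite muln_gt0 n0 expn_gt0.
have ck0 : 0 < c ^+ (2 ^ k) by rewrite exprn_gt0.
rewrite exprMn -exprM -ler_pdivlMr//.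
apply: capacity_le Qm Qs _ _ => //; first by rewrite divr_gt0.
move=> z /eP/(iter_sqr_stdint k P z)/normc_stdint Fz.
rewrite hornerZ Normc.normcM Normc.normcV Fl normcX mulrC.
by rewrite ler_wpM2r// invr_ge0 ltW.
Qed.

End Capacity.

(** * Zeros of the iterates near a given point of the preimage *)

Section Zeros.
Context {R : realType}.

(** The substitution 2 cos t conjugates y^2 - 2 to the doubling of the angle. *)
Lemma iter_sqr_cos k (t : R) :
  iter k (fun y => y ^+ 2 - 2) (2 * cos t) = 2 * cos ((2 ^ k)%:R * t).
Proof.
elim: k => [|k IH] /=; first by rewrite expn0 mul1r.
by rewrite IH expnSr natrM mulrAC mulr_natr cos_mulr2n; ring.
Qed.

Lemma cos_pihalfDpi (j : nat) : cos (pi / 2 + j%:R * pi : R) = 0.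
Proof.
elim: j => [|j IH]; first by rewrite mul0r addr0 cos_pihalf.
by rewrite -[j.+1%:R]natr1 [(_ + 1) * _]mulrDl mul1r addrA cosDpi IH oppr0.
Qed.

(** The points 2 cos((j + 1/2) pi / 2^k) with 0 <= j < 2^k are zeros of the k-th iterate. Their
    angles are equally spaced, so for large k there are m consecutive ones close to arccos(w /
    2). *)
Lemma iter_sqr_zeros (w : R) (d : R) (m : nat) : w \in `[-2, 2] -> 0 < d ->
  exists k, exists2 s : seq R, uniq s /\ size s = m &
    {in s, forall x, `|x - w| <= d /\ iter k (fun y => y ^+ 2 - 2) x = 0}.
Proof.
rewrite in_itv /= => /andP[w2 w2'] d0.
have w1 : -1 <= w / 2 <= 1 by apply/andP; split; lra.
have [/andP[t0 tpi] ct] := acos_def w1; set t := acos _ in t0 tpi ct.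
have pi0 := pi_gt0 R.
have d2 : 0 < d / 2 by rewrite divr_gt0.
have /cvgrPdist_le/(_ _ d2) := @continuous_cos R t.
move=> /nbhs_ballP[h /= h0 H].
have cosh t' : `|t - t'| < h -> `|2 * cos t' - w| <= d.
  move=> tt'; have : `|cos t - cos t'| <= d / 2 by apply: H.
  rewrite distrC ct !ler_norml => /andP[? ?]; apply/andP; split; lra.
(* Large enough that m + 1 angular spacings are shorter than h, and that there are at least m
   angles. *)
pose k := (Num.truncn (m.+1%:R * pi / h) + m).+1.
have k2 : m.+1%:R * pi / h < (2 ^ k)%:R.
  apply: (@lt_le_trans _ _ (Num.truncn (m.+1%:R * pi / h)).+1%:R);
    first exact: truncnS_gt.
  by rewrite ler_nat (leq_trans (_ : _ <= k)%N) ?(ltnW (ltn_expl _ _))//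
    /k ltnS leq_addr.
have mk : (m <= 2 ^ k)%N.
  by rewrite (leq_trans (_ : _ <= k)%N) ?(ltnW (ltn_expl _ _))// /k leqW//
    leq_addl.
set N := (2 ^ k)%N in k2 mk.
have N0 : 0 < N%:R :> R by rewrite ltr0n expn_gt0.
pose u := N%:R * t / pi.
have u0 : 0 <= u by rewrite /u divr_ge0 ?mulr_ge0 ?(ltW pi0).
have uN : u <= N%:R by rewrite /u ler_pdivrMr// ler_pM2l.
(* The first of m consecutive indices near u, moved down if necessary so that all of them stay below
   N; this matters for w near -2. *)
pose j0 := minn (Num.truncn u) (N - m).
pose th j : R := (j%:R + 2^-1) * pi / N%:R.
have th_inj : injective th.
  move=> i j /(congr1 ( *%R^~ N%:R)); rewrite /th !divfK ?gt_eqF//.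
  move=> /(mulIf (lt0r_neq0 pi0))/addIr/eqP; rewrite eqr_nat => /eqP//.
have j0N : (j0 + m <= N)%N.
  by rewrite -[leqRHS](subnK mk) leq_add2r geq_minr.
have th_itv j : (j < N)%N -> th j \in `[0, pi].
  move=> jN; rewrite in_itv /= /th; apply/andP; split.
    by apply: divr_ge0 => //; apply: mulr_ge0; [apply: addr_ge0;
      rewrite ?invr_ge0|exact: ltW].
  rewrite ler_pdivrMr// mulrC ler_pM2l//.
  have : j.+1%:R <= N%:R :> R by rewrite ler_nat.
  rewrite -natr1; lra.
have th_near j : (j0 <= j < j0 + m)%N -> `|t - th j| < h.
  move=> /andP[jl ju].
  have -> : t - th j = (u - (j%:R + 2^-1)) * pi / N%:R.
    rewrite /u /th; move: (pi) pi0 => p p0; field.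
    by rewrite !gt_eqF.
  have um : `|u - (j%:R + 2^-1)| <= m.+1%:R.
    have jl' : j0%:R <= j%:R :> R by rewrite ler_nat.
    have ju' : j%:R + 1 <= j0%:R + m%:R :> R by rewrite natr1 -natrD ler_nat.
    have /andP[tl tu] := truncn_itv u0.
    have j0u : j0%:R <= u by rewrite (le_trans _ tl)// ler_nat geq_minl.
    have uj0 : u <= j0%:R + m%:R + 1.
      rewrite /j0 /minn; case: ifP => _.
        by rewrite (le_trans (ltW tu))// -natr1; have := ler0n R m; lra.
      by rewrite -natrD subnK// (le_trans uN)// lerDl.
    have := ler0n R m; rewrite -[m.+1%:R]natr1 ler_norml; move=> ?; apply/andP;
      split; lra.
  rewrite !normrM normfV !(gtr0_norm pi0) (gtr0_norm N0) ltr_pdivrMr//.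
  apply: le_lt_trans (ler_wpM2r (ltW pi0) um) _.
  by move: k2; rewrite ltr_pdivrMr// [_ * h]mulrC.
exists k, [seq 2 * cos (th j) | j <- iota j0 m].
  rewrite size_map size_iota; split => //.
  rewrite map_inj_in_uniq ?iota_uniq// => i j;
    rewrite !mem_iota => /andP[_ iN] /andP[_ jN].
  have two0 : 2 != 0 :> R by rewrite pnatr_eq0.
  move=> /(mulfI two0) eq_cos; apply: th_inj; apply: cos_inj eq_cos.
    exact: th_itv (leq_trans iN j0N).
  exact: th_itv (leq_trans jN j0N).
move=> x /mapP[j]; rewrite mem_iota => jj ->{x}; split;
  first exact/cosh/th_near.
rewrite iter_sqr_cos /th.
have -> : (2 ^ k)%:R * ((j%:R + 2^-1) * pi / N%:R) = pi / 2 + j%:R * pi :> R.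
  by rewrite -/N; field; rewrite gt_eqF.
by rewrite cos_pihalfDpi mulr0.
Qed.

(** The distances from z0 to the n roots of P - w multiply to |P(z0) - w| / |c|, with c the leading
    coefficient; they cannot all exceed d if this is at most d^n. *)
Lemma near_preimage (P : {poly R[i]}) (n : nat) (z0 w : R[i]) (d : R) :
  (0 < n)%N -> size P = n.+1 -> 0 < d ->
  normc (P.[z0] - w) <= normc (lead_coef P) * d ^+ n ->
  exists2 z, P.[z] = w & normc (z - z0) <= d.
Proof.
move=> n0 Ps d0 H.
have sw : size (P - w%:P) = n.+1.
  by rewrite size_polyDl ?Ps// size_polyN (leq_ltn_trans (size_polyC_leq1 _)).
have lw : lead_coef (P - w%:P) = lead_coef P.
  by rewrite lead_coefDl// size_polyN Ps (leq_ltn_trans (size_polyC_leq1 _)).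
have [r rE] := closed_field_poly_normal (P - w%:P).
have l0 : lead_coef P != 0 by rewrite lead_coef_eq0 -size_poly_gt0 Ps.
have rn : size r = n.
  by move: sw; rewrite rE lw size_scale// size_prod_XsubC => -[].
apply: contrapT => Hn.
have far : {in r, forall z, d < normc (z0 - z)}.
  move=> z zr; rewrite ltNge; apply/negP => zd; apply: Hn; exists z.
    have /eqP : (P - w%:P).[z] = 0.
      apply/rootP; rewrite rE rootZ ?lw// root_prod_XsubC//.
    by rewrite !hornerE subr_eq0 => /eqP.
  by rewrite normc_sub.
move: H; apply/negP; rewrite -ltNge.
have -> : P.[z0] - w = (P - w%:P).[z0] by rewrite !hornerE.
rewrite rE lw hornerZ Normc.normcM ltr_pM2l ?normc_gt0//.
rewrite horner_prod normc_prod -rn; move: far n0; rewrite -rn; clear -d0.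
elim: r => //= z r IH far _; rewrite big_cons !hornerE exprS.
have zz : d < normc (z0 - z) by apply: far; rewrite inE eqxx.
case: r IH far => [_ _|y r IH far]; first by rewrite big_nil expr0 !mulr1.
apply: ltr_pM => //; [exact: ltW|by rewrite exprn_ge0 ?ltW|].
by apply: IH => // x xr; apply: far; rewrite inE xr orbT.
Qed.

(** Zeros x of the iterated map near P(z0) are lifted to points g x near z0 with P(g x) = x; this
    equation also keeps them distinct. *)
Lemma near_zeros (P : {poly R[i]}) (n : nat) (z0 : R[i]) (d : R) (m : nat) :
  (0 < n)%N -> size P = n.+1 -> 0 < d -> stdint P.[z0] ->
  exists k, exists2 s : seq R[i], uniq s /\ size s = m &
    {in s, forall z, normc (z - z0) <= d /\ root (iter_sqr k P) z}.
Proof.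
move=> n0 Ps d0 [w wI wE].
have l0 : 0 < normc (lead_coef P) by rewrite normc_gt0 lead_coef_eq0
  -size_poly_gt0 Ps.
have dd : 0 < normc (lead_coef P) * d ^+ n by rewrite mulr_gt0// exprn_gt0.
have [k [s [us sm] sH]] := iter_sqr_zeros m wI dd.
have : forall x : R, exists z : R[i], x \in s ->
  P.[z] = x%:C /\ normc (z - z0) <= d.
  move=> x; have [xs|_] := boolP (x \in s); last by exists 0.
  have [xw _] := sH x xs.
  have [|z] := @near_preimage P n z0 x%:C d n0 Ps d0; last by exists z.
  by rewrite -wE -rmorphB normc_real distrC.
move=> /choice[g gH]; exists k, (map g s).
  rewrite size_map; split => //; rewrite map_inj_in_uniq// => x y xs ys gxy.
  apply: complexI; have [<- _] := gH x xs; have [<- _] := gH y ys;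
    by rewrite gxy.
move=> z /mapP[x xs ->{z}]; have [Pgx gx] := gH x xs; split => //.
rewrite /root horner_iter_sqr Pgx.
have [_ x0] := sH x xs.
suff -> : iter k (fun w0 => w0 ^+ 2 - 2) x%:C = (iter k (fun y =>
  y ^+ 2 - 2) x)%:C.
  by rewrite x0.
by elim: k {x0 sH} => //= k ->; rewrite rmorphB rmorphXn rmorph_nat.
Qed.

End Zeros.

(** * Strict upper bound when the set misses a point of the preimage *)

Section Strict.
Context {R : realType}.
Implicit Types (e : set R[i]^o) (P Q : {poly R[i]}).

Lemma normc_sub_sqr (x : R) (z : R[i]) :
  normc (x%:C - z) ^+ 2 = (x - Re z) ^+ 2 + (Im z) ^+ 2.
Proof. by rewrite normc_sqr; case: z => a b /=; rewrite sub0r sqrrN. Qed.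

(* If z0 is not real, S has a double zero at the real part of z0; otherwise its
   zeros are z0 - d and z0 + d, where d is the distance from z0 to e. *)
Lemma small_quadratic e z0 : compact e -> e `<=` realAxis R -> ~ e z0 ->
  exists S : {poly R[i]}, [/\ S \is monic, size S = 3 &
    exists2 b : R, 0 < b & forall z : R[i], e z -> normc S.[z] <=
      normc (z - z0) ^+ 2 - b].
Proof.
move=> ce er ez0.
have quad (a b : R) : let S := ('X - a%:C%:P) ^+ 2 - b%:C%:P : {poly R[i]} in
    [/\ S \is monic, size S = 3 & forall x : R, S.[x%:C] = ((x - a) ^+ 2 -
      b)%:C].
  move=> S; have s2 : size (('X - a%:C%:P : {poly R[i]}) ^+ 2) = 3.
    by rewrite size_exp_XsubC.
  have lt3 : (size (- (b%:C%:P : {poly R[i]}))%R < size (('X - a%:C%:P : {poly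
    R[i]}) ^+ 2))%N.
    by rewrite s2 size_polyN (leq_ltn_trans (size_polyC_leq1 _)).
  split.
  - by rewrite monicE lead_coefDl// -monicE monic_exp// monicXsubC.
  - by rewrite size_polyDl.
  - by move=> x; rewrite !hornerE -rmorphB -rmorphXn -rmorphB.
have [d d0 dz] := closed_dist (compact_closedC ce) ez0.
have [Im0|Im0] := eqVneq (Im z0) 0.
  have [Sm Ss SE] := quad (Re z0) (d ^+ 2); eexists; split;
    [exact: Sm|exact: Ss|].
  exists (d ^+ 2); first by rewrite exprn_gt0.
  move=> z ez; have := dz z ez; have [x _ xz] := er z ez;
    rewrite -xz SE normc_real.
  rewrite normc_sub_sqr Im0 expr0n addr0 => dx.
  rewrite ger0_norm// subr_ge0.
  have : d ^+ 2 <= normc (x%:C - z0) ^+ 2 by rewrite lerXn2r ?nnegrE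
    ?normc_ge0// ltW.
  by rewrite normc_sub_sqr Im0 expr0n addr0.
have [Sm Ss SE] := quad (Re z0) 0; eexists; split; [exact: Sm|exact: Ss|].
exists (Im z0 ^+ 2); first by rewrite lt_def sqrf_eq0 Im0 sqr_ge0.
move=> z ez; have [x _ xz] := er z ez; rewrite -xz SE normc_real.
by rewrite subr0 ger0_norm ?sqr_ge0// normc_sub_sqr addrK.
Qed.

(** Write an iterate as A times 2 K linear factors with zeros near z0. Then A S^K has the same
    degree and leading coefficient, and on e it is smaller by the factor rho^K, where K is chosen
    first so that 2 rho^K < 1. *)
Lemma capacity_lt_lead e P n z0 : compact e -> e `<=` realAxis R ->
  (0 < n)%N -> size P = n.+1 -> (forall z : R[i], e z -> stdint P.[z]) ->
  stdint P.[z0] -> ~ e z0 ->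
  capacity e ^+ n < (normc (lead_coef P))^-1.
Proof.
move=> ce er n0 Ps eP Pz0 ez0; set c := normc _.
have c0 : 0 < c by rewrite normc_gt0 lead_coef_eq0 -size_poly_gt0 Ps.
have [S [Sm Ss [b b0 Sb]]] := small_quadratic ce er ez0.
have [d d0 dz] := closed_dist (compact_closedC ce) ez0.
have [B0 B01 eB0] := compact_boundedC ce.
pose B := B0 + normc z0.
have B1 : 0 < B by rewrite /B ltr_pwDl ?normc_ge0// (lt_le_trans _ B01).
have eB z : e z -> normc (z - z0) <= B.
  by move=> /eB0 h; rewrite (le_trans (le_normcD _ _))// normcN lerD2r.
(* With Y = |z - z0| in [d, B], the first bound keeps Y - d' positive; the second gives Y^2 - (Y -
   d')^2 <= 2 B d' <= b / 2, so half of the gain b survives. *)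
pose d' := Num.min (d / 2) (b / (4 * B)).
have d'0 : 0 < d' by rewrite lt_min !divr_gt0// mulr_gt0.
(* Chosen so that y - b / 2 <= rho y whenever 0 <= y <= B^2, which turns the additive gain into a
   factor. *)
pose rho := B ^+ 2 / (B ^+ 2 + b / 2).
have W0 : 0 < B ^+ 2 + b / 2 by rewrite addr_gt0 ?exprn_gt0 ?divr_gt0.
have rho0 : 0 < rho by rewrite divr_gt0 ?exprn_gt0.
have Srho z : e z -> d' <= normc (z - z0) /\
    normc S.[z] <= rho * (normc (z - z0) - d') ^+ 2.
  move=> ez; have := Sb z ez; have := dz z ez; have := eB z ez.
  set Y := normc (z - z0); set s := normc S.[z] => YB dY sY.
  have d'd : d' <= d / 2 by rewrite ge_min lexx.
  have d'b : d' * (4 * B) <= b.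
    by rewrite -ler_pdivlMr ?mulr_gt0// ge_min lexx orbT.
  have d'Y : d' <= Y by lra.
  split => //.
  set y := (Y - d') ^+ 2.
  have sy : s <= y - b / 2 by rewrite /y; nra.
  have yB : y <= B ^+ 2.
    by rewrite /y ler_pXn2r ?nnegrE ?subr_ge0 ?(ltW B1)//; lra.
  rewrite /rho mulrAC ler_pdivlMr//.
  have := ltW b0; nra.
have [j rhoj] : exists j, rho ^+ (2 ^ j) * 2 < 1.
  apply: contrapT => Hn.
  have : rho^-1 <= 1.
    apply: expr_pow2_le => [|j]; first by rewrite invr_ge0 ltW.
    rewrite exprVn -[_^-1]mul1r ler_pdivrMr ?exprn_gt0// mulrC leNgt.
    by apply/negP => h; apply: Hn; exists j.
  rewrite invf_le1// leNgt => /negP; apply.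
  by rewrite /rho ltr_pdivrMr// mul1r ltrDl divr_gt0.
set K := (2 ^ j)%N in rhoj.
have [k [s [us sK] sH]] := near_zeros (2 * K) n0 Ps d'0 Pz0.
have [Fs Fl] := size_lead_iter_sqr k n0 Ps.
have [||A FE] := uniq_roots_prod_XsubC (p := iter_sqr k P) (rs := s).
- by apply/allP => z /sH[].
- by rewrite uniq_rootsE.
have nk0 : (0 < n * 2 ^ k)%N by rewrite muln_gt0 n0 expn_gt0.
have ck0 : 0 < c ^+ (2 ^ k) by rewrite exprn_gt0.
have sXm : \prod_(z <- s) ('X - z%:P) \is monic by apply: monic_prod_XsubC.
have A0 : A != 0.
  by apply/eqP => A0; move: Fs; rewrite FE A0 mul0r size_poly0.
have QFs : size (A * S ^+ K) = (n * 2 ^ k).+1.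
  rewrite -Fs FE !size_Mmonic ?monic_exp// size_prod_XsubC sK.
  rewrite -(prednK (_ : 0 < size (S ^+ K))%N) ?size_poly_gt0 ?monic_neq0
    ?monic_exp//.
  by rewrite size_exp Ss.
have QFl : lead_coef (A * S ^+ K) = lead_coef P ^+ (2 ^ k).
  by rewrite -Fl FE !lead_coef_Mmonic ?monic_exp.
have [Qm Qs] := monic_scale QFs.
rewrite -[ltRHS]mul1r ltr_pdivlMr//.
(* If C(e)^n c were at least 1, so would be its power 2^k, which the polynomial A S^K bounds by 2
   rho^K < 1. *)
rewrite ltNge; apply/negP => h.
suff : 1 <= rho ^+ K * 2 by rewrite leNgt rhoj.
rewrite -[leLHS](expr1n _ (2 ^ k)).
apply: (@le_trans _ _ ((capacity e ^+ n * c) ^+ (2 ^ k))).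
  by rewrite lerXn2r ?nnegrE// mulr_ge0 ?exprn_ge0 ?capacity_ge0 ?ltW.
rewrite exprMn -exprM -ler_pdivlMr//.
apply: capacity_le Qm Qs _ _ => //;
  first by rewrite divr_gt0// mulr_gt0// exprn_gt0.
move=> z ez; have /(iter_sqr_stdint k P z)/normc_stdint Fz := eP z ez.
have [d'Y Sz] := Srho z ez.
rewrite hornerZ Normc.normcM Normc.normcV QFl normcX mulrC ler_wpM2r ?invr_ge0
  ?(ltW ck0)//.
apply: (@le_trans _ _ (rho ^+ K * normc (iter_sqr k P).[z])); last first.
  by rewrite ler_wpM2l// exprn_ge0// ltW.
rewrite FE !hornerM !Normc.normcM mulrCA ler_wpM2l ?normc_ge0//.
rewrite horner_exp normcX horner_prod normc_prod.
apply: (@le_trans _ _ ((rho * (normc (z - z0) - d') ^+ 2) ^+ K)).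
  by rewrite lerXn2r ?nnegrE ?normc_ge0 ?(le_trans (normc_ge0 _) Sz).
rewrite exprMn ler_wpM2l ?exprn_ge0 ?(ltW rho0)// -exprM -sK.
(* All 2 K zeros lie within d' of z0, so the product of the linear factors at z is at least (Y -
   d')^(2K). *)
have : {in s, forall y, normc (z - z0) - d' <= normc (z - y)}.
  move=> y /sH[yz _]; rewrite lerBlDr.
  have -> : z - z0 = (z - y) + (y - z0) by rewrite addrA subrK.
  by rewrite (le_trans (le_normcD _ _))// lerD2l.
have : 0 <= normc (z - z0) - d' by rewrite subr_ge0.
clear; move: (_ - d') => u u0; elim: s => [|y s IH] H;
  first by rewrite big_nil expr0.
rewrite big_cons exprS !hornerE ler_pM ?exprn_ge0//.
  by apply: H; rewrite inE eqxx.
by apply: IH => x xs; apply: H; rewrite inE xs orbT.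
Qed.

End Strict.

(** * Measurable enumeration of real roots and means of image measures *)

Section Roots.
Context {R : realType}.

Lemma seq_has_max (s : seq R) : s != [::] ->
  exists2 m, m \in s & {in s, forall x, x <= m}.
Proof.
elim: s => // x s IH _; have [->|/IH[m ms mx]] := eqVneq s [::].
  by exists x => [|y]; rewrite inE // => /eqP ->.
exists (Num.max x m).
  by rewrite /Num.max; case: ifP => _; rewrite inE ?eqxx ?ms ?orbT.
by move=> y; rewrite inE le_max => /orP[/eqP ->|/mx ->]; rewrite ?lexx ?orbT.
Qed.

(** Up to order, the coefficients are the elementary symmetric functions of positive numbers. *)
Lemma coef_prod_pos (s : seq R) i : {in s, forall x, 0 < x} -> (i <=
    size s)%N ->
  0 < (\prod_(x <- s) ('X + x%:P))`_i.
Proof.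
elim: s i => [|x s IH] i sp; first by rewrite leqn0 big_nil => /eqP ->;
  rewrite coef1.
have x0 : 0 < x by apply: sp; rewrite inE eqxx.
have {}IH j : (j <= size s)%N -> 0 < (\prod_(y <- s) ('X + y%:P))`_j.
  by apply: IH => y ys; apply: sp; rewrite inE ys orbT.
have sz : size (\prod_(y <- s) ('X + y%:P)) = (size s).+1.
  under eq_bigr do rewrite -[X in _ + X]opprK -polyCN.
  by rewrite size_prod_XsubC.
rewrite big_cons mulrDl coefD coefXM mul_polyC coefZ.
case: i => [_|i]; first by rewrite add0r mulr_gt0// IH.
rewrite /= ltnS => si; rewrite ltr_pwDl ?IH//.
have [si1|si1] := leqP i.+1 (size s); first by rewrite mulr_ge0 ?ltW ?IH.
by rewrite nth_default ?mulr0// sz.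
Qed.

(* Makes the largest root a measurable function of the coefficients. *)
Lemma max_root_ltP (s : seq R) (m a : R) : m \in s -> {in s, forall x, x <=
    m} ->
  (m < a) <-> (forall i, (i <= size s)%N ->
     0 < ((\prod_(x <- s) ('X - x%:P)) \Po ('X + a%:P))`_i).
Proof.
move=> ms mx.
have E : (\prod_(x <- s) ('X - x%:P)) \Po ('X + a%:P) =
    \prod_(y <- [seq a - x | x <- s]) ('X + y%:P).
  rewrite rmorph_prod /= big_map; apply: eq_bigr => x _.
  by rewrite rmorphB /= comp_polyX comp_polyC -addrA polyCB.
have Es : size [seq a - x | x <- s] = size s by rewrite size_map.
rewrite E; split => [ma i si|H].
  apply: coef_prod_pos; last by rewrite Es.
  by move=> _ /mapP[x /mx xm ->]; rewrite subr_gt0 (le_lt_trans xm).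
rewrite ltNge; apply/negP => am.
(* A polynomial with positive coefficients is positive at m - a >= 0, whereas m - a is a root of the
   shifted polynomial. *)
have : 0 < (\prod_(y <- [seq a - x | x <- s]) ('X + y%:P)).[m - a].
  rewrite (@horner_coef_wide _ (size s).+1); last first.
    rewrite -Es; under eq_bigr do rewrite -[X in _ + X]opprK -polyCN.
    by rewrite size_prod_XsubC.
  rewrite big_ord_recl /= expr0 mulr1 ltr_pwDl ?H// sumr_ge0// => i _.
  by rewrite mulr_ge0 ?exprn_ge0 ?subr_ge0// ltW// H.
rewrite -E horner_comp !hornerE subrK horner_prod.
by rewrite (big_rem m)//= !hornerE subrr mul0r ltxx.
Qed.

Context d (T : measurableType d).

Lemma measurable_max_root (N : nat) (r : T -> seq R) (m : T -> R) :
  (forall t, size (r t) = N) ->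
  (forall i, measurable_fun setT (fun t =>
    (\prod_(x <- r t) ('X - x%:P))`_i)) ->
  (forall t, m t \in r t /\ {in r t, forall x, x <= m t}) ->
  measurable_fun setT m.
Proof.
move=> rN mr mP; apply: (measurability _ (RGenCInfty.measurableE R)) =>
  _ [_ [a ->] <-].
rewrite setTI.
pose g i t := ((\prod_(x <- r t) ('X - x%:P)) \Po ('X + a%:P))`_i.
have mg i : measurable_fun setT (g i).
  have -> : g i = fun t => \sum_(j < N.+1)
      (\prod_(x <- r t) ('X - x%:P))`_j * (('X + a%:P) ^+ j)`_i.
    apply/funext => t; rewrite /g coef_comp_poly size_prod_XsubC rN.
    by [].
  by apply: measurable_sum => j; apply: measurable_funM.
have -> : m @^-1` `[a, +oo[ = ~` \bigcap_(i in [set i | (i <=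
  N)%N]) (g i @^-1` `]0, +oo[).
  apply/seteqP; split => t /=.
    rewrite in_itv /= andbT => am H; move: am; rewrite leNgt => /negP; apply.
    apply/(max_root_ltP _ (mP t).1 (mP t).2) => i; rewrite rN => iN.
    by have := H i iN; rewrite /= in_itv/= andbT.
  move=> H; rewrite in_itv /= andbT leNgt; apply/negP => ma; apply: H => i iN.
  rewrite /= in_itv/= andbT; have := (max_root_ltP a (mP t).1 (mP t).2).1 ma i.
  by rewrite rN => /(_ iN).
apply: measurableC; apply: bigcap_measurable => //; first by exists 0%N.
by move=> i _; rewrite -[X in measurable X]setTI; apply: mg.
Qed.

(** The largest root is measurable; it is split off and the induction continues with the remaining
    roots, which lists the roots in decreasing order. *)
Lemma measurable_roots (N : nat) (r : T -> seq R) :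
  (forall t, size (r t) = N) ->
  (forall i, measurable_fun setT (fun t =>
    (\prod_(x <- r t) ('X - x%:P))`_i)) ->
  exists psi : nat -> T -> R, (forall j, measurable_fun setT (psi j)) /\
    (forall t, perm_eq (r t) [seq psi j t | j <- iota 0 N]).
Proof.
elim: N r => [|N IH] r rN mr.
  exists (fun _ _ => 0); split => // t; by rewrite (size0nil (rN t)).
have : forall t, exists m, m \in r t /\ {in r t, forall x, x <= m}.
  move=> t; have : r t != [::] by rewrite -size_eq0 rN.
  by move=> /seq_has_max[m ? ?]; exists m.
move=> /choice[m mP].
have mm := measurable_max_root rN mr mP.
pose q t := rem (m t) (r t).
have rE t : \prod_(x <- r t) ('X - x%:P) =
    ('X - (m t)%:P) * \prod_(x <- q t) ('X - x%:P).
  by rewrite (big_rem (m t)) ?(mP t).1.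
have qN t : size (q t) = N by rewrite /q size_rem ?(mP t).1// rN.
have mq i : measurable_fun setT (fun t => (\prod_(x <- q t) ('X - x%:P))`_i).
  (* Synthetic division from the top coefficient down: each coefficient of the quotient is obtained
     from the next higher one. *)
  have [k] := ubnP (N.+1 - i); elim: k i => // k IHk i Hk.
  have [iN|iN] := leqP i N; last first.
    rewrite (_ : (fun _ => _) = cst 0)//; apply/funext => t.
    by rewrite nth_default// size_prod_XsubC qN.
  rewrite (_ : (fun _ => _) = fun t => (\prod_(x <- r t) ('X - x%:P))`_i.+1 +
      m t * (\prod_(x <- q t) ('X - x%:P))`_i.+1).
    apply: measurable_funD => //; apply: measurable_funM => //; apply: IHk.
    by move: Hk iN; lia.
  apply/funext => t; rewrite rE mulrBl coefB coefXM /= mul_polyC coefZ.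
  by rewrite subrK.
have [psi [mpsi psiE]] := IH q qN mq.
exists (fun j => if j is j'.+1 then psi j' else m); split; first by case.
move=> t; rewrite (perm_trans (perm_to_rem (mP t).1))//= perm_cons.
rewrite (perm_trans (psiE t))// -[1%N]addn0 iotaDl -map_comp.
exact: perm_refl.
Qed.

End Roots.

(** The measure is 1/N times the sum of the image measures of [lam] under the [psi j]; later
    arguments use it only through this integral formula. *)
Lemma mixture_probability d d' (T : measurableType d) (S : measurableType d')
    (R : realType) (lam : probability T R) (N : nat) (psi : nat -> T -> S) :
  (0 < N)%N -> (forall j, measurable_fun setT (psi j)) ->
  exists mu : probability S R,
    forall f : S -> \bar R, measurable_fun setT f -> (forall x, (0 <= f x)%E) ->
    (\int[mu]_x f x = N%:R^-1%:E * \int[lam]_t \sum_(j < N) f (psi j t))%E.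
Proof.
move=> N0 mpsi.
pose phi j : {mfun T >-> S} := HB.pack (psi j) (isMeasurableFun.Build _ _ _ _ _
  (mpsi j)).
pose pm j : {measure set S -> \bar R} := pushforward lam (phi j).
pose m_ := pm mpsi.
have c0 : 0 <= N%:R^-1 :> R by rewrite invr_ge0.
pose c : {nonneg R} := NngNum c0.
pose mu : {measure set S -> \bar R} := mscale c (msum m_ N).
have muT : mu setT = 1%E.
  rewrite /mu /= /mscale /= /msum /=.
  under eq_bigr do rewrite /m_ /= /pushforward preimage_setT probability_setT.
  by rewrite sumEFin -EFinM sumr_const card_ord mulVf// pnatr_eq0 -lt0n.
pose mu' : probability S R := HB.pack (mscale c (msum m_ N))
  (Measure_isProbability.Build _ _ _ (mscale c (msum m_ N)) muT).
exists mu' => f mf f0.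
rewrite [LHS](_ : _ = \int[mscale c (msum m_ N)]_x f x)%E//.
rewrite ge0_integral_mscale// ge0_integral_measure_sum//; congr (_ * _)%E.
rewrite (ge0_integral_sum lam measurableT)//.
  by apply: eq_bigr => j _; rewrite ge0_integral_pushforward.
by move=> j; apply: measurableT_comp.
Qed.

(** * The logarithmic potential of the uniform law on [-2,2] *)

Section UniformPotential.
Context {R : realType}.
Local Open Scope ereal_scope.

(** The positive part of - ln r. Truncation can only increase a potential, which is harmless for
    upper bounds, and it makes the integrand nonnegative. *)
Definition poslog (r : R) : \bar R := maxe (- lne r%:E) 0.

Lemma measurable_poslog d (T : measurableType d) (f : T -> R) :
  measurable_fun setT f -> measurable_fun setT (fun t => poslog (f t)).
Proof.
move=> mf; apply: measurable_maxe => //.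
apply: (@measurableT_comp _ _ _ _ _ _ (@oppe R)); first exact: oppe_measurable.
rewrite /lne /=; apply: measurable_fun_ifT => //.
  exact: measurable_fun_ler.
by apply/measurable_EFinP; exact: measurableT_comp.
Qed.

(* Summing over k gives ln 2 times the number of powers of 1/2 that are at
   least r, an upper bound for - ln r. *)
Let level (r : R) (k : nat) : \bar R := (ln 2 * ((r <= 2^-1 ^+ k)%R)%:R)%:E.

Let ln2 : (0 < ln 2 :> R)%R.
Proof. by rewrite ln_gt0// ltr1n. Qed.

Let level_ge0 r k : 0 <= level r k.
Proof. by rewrite lee_fin mulr_ge0// ltW. Qed.

Let level_sum r n : (r <= 2^-1 ^+ n)%R ->
  \sum_(0 <= k < n.+1) level r k = (n.+1%:R * ln 2)%:E.
Proof.
move=> rn; rewrite (eq_big_nat _ _ (F2 := fun _ => (ln 2)%:E)).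
  by rewrite sumEFin sumr_const_nat subn0 mulr_natl.
move=> k /andP[_ kn]; rewrite /level (le_trans rn) ?mulr1//.
by rewrite ler_wiXn2l ?invr_ge0// invf_le1// ler1n.
Qed.

Let le_level_sum r n : (2^-1 ^+ n < r)%R ->
  (- ln r)%:E <= \sum_(0 <= k < n) level r k.
Proof.
elim: n => [|n IH] rn.
  by rewrite big_nil lee_fin oppr_le0 ln_ge0// ltW.
have r0 : (0 < r)%R by rewrite (lt_trans _ rn)// exprn_gt0// invr_gt0.
have [rn'|rn'] := leP r (2^-1 ^+ n)%R.
  rewrite level_sum// lee_fin lerNl -[leRHS](expRK (ln r)) (lnK r0).
  rewrite -(expRK (- _)%R) ler_ln ?posrE ?expR_gt0// ltW//.
  by rewrite expRN mulrC expRM_natr lnK ?posrE// -exprVn.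
by rewrite big_nat_recr//= (le_trans (IH rn'))// leeDl.
Qed.

Lemma poslog_le (r : R) : (0 <= r)%R -> poslog r <= \sum_(0 <= k <oo) level r k.
Proof.
move=> r0; rewrite /poslog ge_max nneseries_ge0//.
rewrite andbT; move: r0; rewrite le_eqVlt => /predU1P[<-|r0].
  have -> : \sum_(0 <= k <oo) level 0%R k = +oo; last by rewrite leey.
  apply/eqyP => A A0; pose n := Num.truncn (A / ln 2).
  have An : (A <= n.+1%:R * ln 2)%R.
    by rewrite -ler_pdivrMr// ltW// truncnS_gt.
  apply: (@le_trans _ _ (n.+1%:R * ln 2)%:E); first by rewrite lee_fin.
  rewrite -(@level_sum 0%R n) ?exprn_ge0 ?invr_ge0//.
  by apply: nneseries_lim_ge => k _ _; exact: level_ge0.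
rewrite /lne ifF; last by apply/negbTE; rewrite -ltNge.
pose n := Num.truncn (r^-1)%R.
have nr : (2^-1 ^+ n.+1 < r)%R.
  rewrite exprVn -[ltRHS]invrK ltf_pV2 ?posrE ?exprn_gt0 ?invr_gt0//.
  rewrite (lt_trans (truncnS_gt _))// -natrX ltr_nat ltn_expl//.
apply: (le_trans (le_level_sum nr)).
by apply: nneseries_lim_ge => k _ _; exact: level_ge0.
Qed.

(** Extends functions on [-2,2] to the whole line, on which the uniform law is defined. *)
Definition clamp (t : R) : R := (Num.max (- 2) (Num.min t 2))%R.

Lemma clamp_itv t : clamp t \in `[(- 2)%R, 2%R].
Proof.
rewrite in_itv /= /clamp le_max lexx /= ge_max ge_min lexx orbT andbT.
by rewrite (@le_trans _ _ 0%R)// oppr_le0.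
Qed.

Lemma clampK t : t \in `[(- 2)%R, 2%R] -> clamp t = t.
Proof. by rewrite in_itv /= => /andP[t2 t2']; rewrite /clamp min_l// max_r. Qed.

Lemma measurable_clamp : measurable_fun setT clamp.
Proof. by apply: measurable_maxr => //; exact: measurable_minr. Qed.

(** The k-th level set |u - t| <= 2^-k has length at most 2 * 2^-k. With the density 1/4 it
    contributes at most ln 2 / 2^(k+1), and these terms add up to ln 2. *)
Lemma uniform_potential_le (ab : (- 2 < 2 :> R)%R) (u : R) :
  \int[uniform_prob ab]_t poslog `|u - clamp t|%R <= (ln 2)%:E.
Proof.
rewrite integral_uniform; last 2 first.
- apply: measurable_poslog; apply: (@measurableT_comp _ _ _ _ _ _ (@Num.norm R
  R)) => //.
  by apply: measurable_funB => //; exact: measurable_clamp.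
- by move=> t; rewrite /poslog le_max lexx orbT.
have -> : (2 - - 2 = 4 :> R)%R by ring.
pose J k : set R := `[(u - 2^-1 ^+ k)%R, (u + 2^-1 ^+ k)%R]%classic.
have levelE k (t : R) : level `|u - t|%R k = (ln 2 * \1_(J k) t)%:E.
  rewrite /level indicE mem_setE in_itv /= ler_norml;
    congr (_ * (nat_of_bool _)%:R)%:E.
  by rewrite lerBrDr lerBlDr; apply/andP/andP => -[? ?]; split; lra.
have mlevel k : measurable_fun setT (fun t : R => level `|u - t|%R k).
  under eq_fun do rewrite levelE.
  apply/measurable_EFinP; apply: measurable_funM => //.
  by apply: measurable_indic; exact: measurable_itv.
have int_level k : \int[lebesgue_measure]_(t in `[(- 2)%R, 2%R]) level `|u -
  t|%R k <=
    ((4 * ln 2) / (2 ^ k.+1)%:R)%:E.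
  pose h : R := (2^-1 ^+ k)%R.
  have h0 : (0 < h)%R by rewrite exprn_gt0// invr_gt0.
  under eq_integral do rewrite levelE EFinM.
  rewrite ge0_integralZl_EFin//; last 2 first.
    apply/measurable_EFinP; apply: measurable_funTS; apply: measurable_indic;
      exact: measurable_itv.
  - exact: ltW.
  rewrite integral_indic//; last exact: measurable_itv.
  apply: (@le_trans _ _ ((ln 2)%:E * lebesgue_measure (J k))).
    apply: lee_wpmul2l; first by rewrite lee_fin ltW.
    apply: le_measure; rewrite ?inE; [|exact: measurable_itv|exact: subIsetl].
    by apply: measurableI; exact: measurable_itv.
  rewrite /J lebesgue_measure_itv/= lte_fin -/h ifT;
    last by rewrite ltrD2l gtrN.
  rewrite -EFinD -EFinM lee_fin expnS natrM natrX /h exprVn.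
  rewrite le_eqVlt; apply/orP; left; apply/eqP; field.
  by rewrite expf_neq0// pnatr_eq0.
apply: (@le_trans _ _ (4^-1%:E * (4 * ln 2)%:E)); last first.
  by rewrite -EFinM mulrA mulVf ?mul1r// pnatr_eq0.
rewrite lee_pmul2l// ?lte_fin ?invr_gt0//.
apply: (@le_trans _ _ (\int[lebesgue_measure]_(t in `[(- 2)%R, 2%R])
    \sum_(0 <= k <oo) level `|u - t|%R k)).
  apply: ge0_le_integral => //.
  - by move=> t _; rewrite /poslog le_max lexx orbT.
  - apply: measurable_funTS; apply: measurable_poslog;
    apply: (@measurableT_comp _ _ _ _ _ _ (@Num.norm R R)) => //.
    by apply: measurable_funB => //; exact: measurable_clamp.
  - by apply: measurable_funTS; apply: ge0_emeasurable_sum => k *;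
    [exact: level_ge0|exact: mlevel].
  - by move=> t tI; rewrite clampK//; exact: poslog_le.
rewrite integral_nneseries//; last first.
  by move=> k; apply: measurable_funTS; exact: mlevel.
apply: le_trans (epsilon_trick0 xpredT _); last by rewrite mulr_ge0// ltW.
apply: lee_nneseries => k *; first by apply: integral_ge0 => t _;
  exact: level_ge0.
exact: int_level.
Qed.

End UniformPotential.

(** * Measurable real roots of F - t for t in [-2,2] *)

Section Preimage.
Context {R : realType}.
Implicit Types (e : set R[i]^o) (P Q : {poly R[i]}).

Lemma stdint_real (x : R) : x \in `[(- 2), 2] -> stdint x%:C.
Proof. by move=> xI; exists x. Qed.

(** Since the preimage of [-2,2] is real, F - t splits over the reals. Only the constant coefficient
    varies with t, and it does so affinely, so the coefficients are measurable and the roots can be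
    enumerated measurably. *)
Lemma preimage_roots (F : {poly R[i]}) (N : nat) : (0 < N)%N -> size F = N.+1 ->
  (forall z : R[i], stdint F.[z] -> realAxis R z) ->
  exists psi : nat -> R -> R, (forall j, measurable_fun setT (psi j)) /\
    (forall t, F - (clamp t)%:C%:P =
       lead_coef F *: \prod_(j < N) ('X - (psi j t)%:C%:P)).
Proof.
move=> N0 Fs Fr.
pose L := lead_coef F.
have L0 : L != 0 by rewrite lead_coef_eq0 -size_poly_gt0 Fs.
have sw (w : R) : (size (- (w%:C%:P : {poly R[i]}))%R < size F)%N.
  by rewrite size_polyN (leq_ltn_trans (size_polyC_leq1 _))// Fs.
have : forall t, exists r : seq R, size r = N /\
    F - (clamp t)%:C%:P = L *: map_poly (real_complex R) (\prod_(x <- r) ('X -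
      x%:P)).
  move=> t; have [r rE] := closed_field_poly_normal (F - (clamp t)%:C%:P).
  rewrite lead_coefDl// -/L in rE.
  have zr z : z \in r -> (Re z)%:C = z.
    move=> zr; have /eqP : (F - (clamp t)%:C%:P).[z] = 0.
      by apply/rootP; rewrite rE rootZ// root_prod_XsubC.
    rewrite !hornerE subr_eq0 => /eqP Fz.
    have [|x _ <-//] := Fr z; rewrite Fz; apply: stdint_real; exact: clamp_itv.
  exists ([seq Re z | z <- r]); split.
    have : size (F - (clamp t)%:C%:P) = N.+1 by rewrite size_polyDl.
    by rewrite rE size_scale// size_prod_XsubC size_map => -[].
  rewrite {1}rE; congr (_ *: _); rewrite rmorph_prod big_map /=.
  apply: eq_big_seq => z /zr zE.
  by rewrite rmorphB /= map_polyX map_polyC /= zE.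
move=> /choice[r rP].
have coefE i t : (\prod_(x <- r t) ('X - x%:P))`_i =
    Re (L^-1 * F`_i) - Re L^-1 * (clamp t * (i == 0)%:R).
  have /(congr1 (fun p : {poly R[i]} => L^-1 * p`_i)) := (rP t).2.
  rewrite coefZ mulKf// coef_map coefB coefC => /(congr1 (@complex.Re R)) /= <-.
  case: (L^-1) => a b; case: (F`_i) => a' b'.
  by case: (i == 0); rewrite /= ?mulr1 ?mulr0; ring.
have mr i : measurable_fun setT (fun t => (\prod_(x <- r t) ('X - x%:P))`_i).
  under eq_fun do rewrite coefE.
  apply: measurable_funB => //; apply: measurable_funM => //;
    apply: measurable_funM => //.
  exact: measurable_clamp.
have [psi [mpsi psiE]] := measurable_roots (fun t => (rP t).1) mr.
exists psi; split => // t; rewrite (rP t).2; congr (_ *: _).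
rewrite (perm_big _ (psiE t)) /= big_map rmorph_prod /= -(big_mkord xpredT
  (fun j => 'X - (psi j t)%:C%:P)) /index_iota subn0.
by apply: eq_bigr => j _; rewrite rmorphB /= map_polyX map_polyC.
Qed.

End Preimage.

(** * Lower bound for the capacity of a full real preimage *)

Section LowerBound.
Context {R : realType}.
Implicit Types (e : set R[i]^o) (P Q : {poly R[i]}).

(* The measure is the mean over j < N of the laws of psi j under the uniform law on
   [-2,2], where psi 0 t, ..., psi (N - 1) t are the roots of F - t. *)
Lemma pulled_back_probability e (F : {poly R[i]}) (N : nat) :
  compact e -> e `<=` realAxis R -> (0 < N)%N -> size F = N.+1 ->
  (forall z : R[i], e z <-> stdint F.[z]) ->
  exists2 mu : probability (borelC R) R, mu (e : set (borelC R)) = 1%E &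
    (log_energy mu <= ((ln (normc (lead_coef F)) + ln 2) / N%:R)%:E)%E.
Proof.
move=> ce er N0 Fs eF.
have Fr z : stdint F.[z] -> realAxis R z by move=> /eF/er.
have [psi [mpsi psiE]] := preimage_roots N0 Fs Fr.
set L := lead_coef F in psiE *; set l := normc L.
have L0 : L != 0 by rewrite lead_coef_eq0 -size_poly_gt0 Fs.
have l0 : 0 < l by rewrite normc_gt0.
have N0R : 0 < N%:R :> R by rewrite ltr0n.
have ab : - 2 < 2 :> R by lra.
pose lam := uniform_prob ab.
pose phi j (t : R) : borelC R := (psi j t)%:C.
have mphi j : measurable_fun setT (phi j).
  exact: (measurableT_comp measurable_complex).
have ephi j t : (j < N)%N -> e (phi j t).
  move=> jN; apply/eF.
  have : (F - (clamp t)%:C%:P).[phi j t] = 0.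
    by rewrite psiE hornerZ horner_prod (bigD1 (Ordinal jN))//= hornerXsubC /phi
      subrr mul0r mulr0.
  rewrite !hornerE => /eqP; rewrite subr_eq0 => /eqP ->.
  by apply: stdint_real; exact: clamp_itv.
have [mu muE] := mixture_probability lam N0 mphi.
have me := closed_measurableC (compact_closedC ce).
have mue : mu (e : set (borelC R)) = 1%E.
  rewrite -[X in mu X]setIT -integral_indic// muE; last 2 first.
  - by apply/measurable_EFinP; exact: measurable_indic.
  - by move=> x; rewrite lee_fin.
  rewrite (eq_integral (cst (N%:R%:E))) => [|t _].
    rewrite integral_cst// [X in (_ * (_ * X))%E](_ : _ = 1%E) ?mule1;
      last exact: probability_setT.
    by rewrite -EFinM mulVf// gt_eqF.
  rewrite /= (eq_bigr (fun _ => 1%E)) => [|j _].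
    by rewrite sumEFin sumr_const card_ord.
  by rewrite indicE mem_set//; apply: ephi.
exists mu => //.
have [B B1 eB] := compact_boundedC ce.
rewrite (log_energyE me B1 eB mue); set c := ln (2 * B).
pose K := ln l + N%:R * c.
(* The distances from z to the N roots of F - t multiply to |F(z) - t| / l, so the kernels add up to
   the kernel of the interval at F(z) and t, plus the constant K. *)
have sumE (z : R[i]) (u : R) t : e z -> F.[z] = u%:C ->
    (\sum_(j < N) nnlogker B ((z : borelC R), phi j t) =
     - lne `|u - clamp t|%:E + K%:E)%E.
  move=> ez Fz.
  rewrite (eq_bigr (fun j : 'I_N =>
    - lne (normc (z - (psi j t)%:C))%:E + c%:E)%E); last first.
    by move=> j _; rewrite (nnlogkerE B1 eB)//; exact: ephi.
  rewrite big_split /= -nlne_prod; last by move=> j; exact: normc_ge0.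
  rewrite sumEFin sumr_const card_ord -mulr_natl.
  have -> : \prod_(j < N) normc (z - (psi j t)%:C) = `|u - clamp t| * l^-1.
    rewrite /l -normc_prod -normc_real rmorphB -Normc.normcV -Normc.normcM.
    have -> : \prod_(j < N) (z - (psi j t)%:C) = (\prod_(j < N) ('X - (psi j
      t)%:C%:P)).[z].
      by rewrite horner_prod; apply: eq_bigr => j _; rewrite !hornerE.
    congr normc; apply: (mulfI L0).
    by rewrite -hornerZ -psiE hornerD hornerN hornerC Fz mulrCA mulfV// mulr1.
  rewrite nlneM ?invr_ge0 ?normc_ge0// (@lne_EFin _ l^-1) ?invr_gt0//
    lnV ?posrE//.
  by rewrite -EFinN opprK -addeA -EFinD.
(* Needed to integrate a sum of nonnegative terms. An endpoint w of [-2,2] at distance at least 1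
   from u is used: the nonnegative sum of kernels equals - ln |u - w| + K, so K >= ln |u - w| >=
   0. *)
have K0 : 0 <= K.
  have ez : e (phi 0%N 0) by apply: ephi.
  have /eF[u uI uE] := ez; move: uI; rewrite /= in_itv /= => /andP[u1 u2].
  have [w wI uw] : exists2 w : R, w \in `[(- 2), 2] & 1 <= `|u - w|.
    have [u0|u0] := leP 0 u.
      exists (- 2); first by rewrite in_itv /= lexx; lra.
      by rewrite ler_normr; apply/orP; left; lra.
    exists 2; first by rewrite in_itv /= lexx andbT; lra.
    by rewrite ler_normr; apply/orP; right; lra.
  have := sumE _ u w ez (esym uE); rewrite (clampK wI) => E.
  have : (0 <= - lne `|u - w|%:E + K%:E)%E.
    by rewrite -E sume_ge0// => j _; exact: nnlogker_ge0.
  rewrite lne_EFin ?(lt_le_trans _ uw)// -EFinN -EFinD lee_fin.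
  have := ln_ge0 uw; lra.
have U_le (z : R[i]) : e z ->
    (\int[mu]_w nnlogker B ((z : borelC R), w) <= (N%:R^-1 * (ln 2 + K))%:E)%E.
  have mGz : measurable_fun setT (fun w : borelC R =>
    nnlogker B ((z : borelC R), w)).
    by apply: measurableT_comp => //; exact: measurable_nnlogker.
  move=> ez; rewrite muE//; last first.
  - by move=> w; exact: nnlogker_ge0.
  rewrite EFinM lee_wpmul2l// ?lee_fin ?invr_ge0//.
  have /eF[u uI uE] := ez.
  have mpl : measurable_fun setT (fun t : R => poslog `|u - clamp t|).
    apply: measurable_poslog; apply: (@measurableT_comp _ _ _ _ _ _ (@Num.norm R
      R)) => //.
    by apply: measurable_funB => //; exact: measurable_clamp.
  apply: (@le_trans _ _ (\int[lam]_t (poslog (`|u - clamp t|)%R + K%:E))%E).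
    apply: ge0_le_integral => //.
    - by move=> t _; rewrite sume_ge0// => j _; exact: nnlogker_ge0.
    - by apply: emeasurable_sum => j; exact: (measurableT_comp mGz (mphi j)).
    - exact: emeasurable_funD.
    - by move=> t _; rewrite (sumE z u)// leeD2r// le_max lexx.
  rewrite (ge0_integralD lam measurableT)//; last first.
    by move=> t _; rewrite /poslog le_max lexx orbT.
  rewrite [leRHS]EFinD; apply: leeD; first exact: uniform_potential_le.
  by rewrite integral_cst// [X in (_ * X)%E](_ : _ = 1%E) ?mule1//;
    exact: probability_setT.
have J_le : (\int[mu]_z \int[mu]_w nnlogker B (z, w) <=
  (N%:R^-1 * (ln 2 + K))%:E)%E.
  have mU : measurable_fun setT (fun z => \int[mu]_w nnlogker B (z, w))%E.
    apply: (measurable_fun_fubini_tonelli_F (nnlogker B));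
      last exact: nnlogker_ge0.
    exact: measurable_nnlogker.
  rewrite muE//; last first.
    by move=> z; apply: integral_ge0 => w _; exact: nnlogker_ge0.
  have C0 : 0 <= N%:R^-1 * (ln 2 + K).
    by rewrite mulr_ge0 ?invr_ge0// addr_ge0// ln_ge0// ler1n.
  apply: (@le_trans _ _ (N%:R^-1%:E * \int[lam]_t (N%:R * (N%:R^-1 * (ln 2 +
    K)))%:E)%E).
    rewrite lee_wpmul2l// ?lee_fin ?invr_ge0//; apply: ge0_le_integral => //.
    - move=> t _; apply: sume_ge0 => j _; apply: integral_ge0 => w _.
      exact: nnlogker_ge0.
    - by apply: emeasurable_sum => j; exact: (measurableT_comp mU (mphi j)).
    - move=> t _; apply: (@le_trans _ _ (\sum_(j < N) (N%:R^-1 * (ln 2 +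
      K))%:E)%E).
        by apply: lee_sum => j _; apply: U_le; exact: ephi.
      by rewrite sumEFin sumr_const card_ord mulr_natl.
  rewrite integral_cst// [X in (_ * (_ * X))%E](_ : _ = 1%E) ?mule1;
    last exact: probability_setT.
  by rewrite -EFinM mulKf ?gt_eqF.
(* As K = ln l + N c, dividing by N leaves exactly the shift c over (ln l + ln 2) / N. *)
rewrite leeBlDr// (le_trans J_le)// -EFinD lee_fin /K.
rewrite le_eqVlt; apply/orP; left; apply/eqP; field.
by rewrite gt_eqF.
Qed.

(** The measures pulled back by the iterates live on the same set [e], and their energy bounds tend
    to ln c / n. *)
Lemma capacity_ge_lead e P n : compact e -> e `<=` realAxis R -> (0 < n)%N ->
  size P = n.+1 -> (forall z : R[i], e z <-> stdint P.[z]) ->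
  (normc (lead_coef P))^-1 <= capacity e ^+ n.
Proof.
move=> ce er n0 Ps eP; set c := normc _.
have c0 : 0 < c by rewrite normc_gt0 lead_coef_eq0 -size_poly_gt0 Ps.
have n0R : 0 < n%:R :> R by rewrite ltr0n.
apply: capacity_ge => //.
  have [Qm Qs] := monic_scale Ps.
  apply: lt_le_trans (robin_ge (M := 2 / c) ce n0 Qm Qs _ _);
    first exact: ltNyr.
    by rewrite divr_gt0.
  move=> z /eP/normc_stdint Pz; rewrite hornerZ Normc.normcM Normc.normcV mulrC.
  by rewrite ler_wpM2r// invr_ge0 ltW.
(* The excess ln 2 / (n 2^(k+1)) is at most d as soon as 2^(k+1) >= ln 2 / d. *)
move=> d d0; pose k := Num.truncn (ln 2 / d).
have kd : ln 2 / (2 ^ k.+1)%:R <= d.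
  rewrite ler_pdivrMr ?ltr0n ?expn_gt0// mulrC -ler_pdivrMr//.
  rewrite (le_trans (ltW (truncnS_gt _)))// ler_nat ltnW// ltn_expl//.
have [Fs Fl] := size_lead_iter_sqr k.+1 n0 Ps.
have nk0 : (0 < n * 2 ^ k.+1)%N by rewrite muln_gt0 n0 expn_gt0.
have [|mu mue muI] := pulled_back_probability ce er nk0 Fs.
  by move=> z; apply: iff_trans (eP z) _; apply: iff_sym;
    exact: iter_sqr_stdint.
exists mu => //; apply: (le_trans muI); rewrite lee_fin Fl normcX lnXn//.
rewrite -/c mulrDl natrM lerD//.
  rewrite -[(_ *+ _) in leLHS]mulr_natl le_eqVlt; apply/orP; left; apply/eqP;
    field.
  by rewrite gt_eqF//= pnatr_eq0 expn_eq0.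
rewrite (le_trans _ kd)// ler_wpM2l ?ln_ge0 ?ler1n//.
rewrite lef_pV2 ?posrE ?mulr_gt0 ?ltr0n ?expn_gt0//.
by rewrite ler_peMl// ler1n.
Qed.

End LowerBound.

(** * Sup norms, the real rescaled polynomial, and the equivalence *)

Section Chebyshev.
Context {R : realType}.
Implicit Types (e : set R[i]^o) (P Q : {poly R[i]}).

(** A real [sup] is an upper bound only for a set bounded above; the coefficients of Q and the bound
    B on [e] provide one. *)
Lemma le_supnorm e Q z : compact e -> e z -> normc Q.[z] <=
    supnorm e (horner Q).
Proof.
move=> ce ez; have [B B1 eB] := compact_boundedC ce.
apply: ub_le_sup; last by exists z.
exists (\sum_(i < size Q) normc Q`_i * B ^+ i) => _ [w ew <-].
rewrite horner_coef (le_trans (le_normc_sum _ _))// ler_sum// => i _.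
rewrite Normc.normcM normcX ler_wpM2l ?normc_ge0// lerXn2r ?nnegrE ?normc_ge0//;
  last exact: eB.
exact: le_trans B1.
Qed.

(** Otherwise the infinite set [e] would lie in the finite zero set of Q. *)
Lemma supnorm_gt0 e Q : compact e -> ~ finite_set e -> Q != 0 ->
  0 < supnorm e (horner Q).
Proof.
move=> ce ie Q0; have [r rE] := closed_field_poly_normal Q.
apply: contrapT => s0; apply: ie;
  apply: sub_finite_set (finite_seq r) => z ez /=.
have Qz : normc Q.[z] <= 0.
  by rewrite (le_trans (le_supnorm Q ce ez))// leNgt; apply/negP.
rewrite -root_prod_XsubC -(@rootZ _ _ (lead_coef Q)) ?lead_coef_eq0// -rE.
by rewrite /root -normc_eq0 eq_le Qz normc_ge0.
Qed.

(** With real parts of the coefficients, the polynomial stays monic and takes the value Re Q(x) at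
    real x, so its modulus on [e] does not exceed t; the factor 2 / t then maps [e] into [-2,2]. *)
Lemma real_rescaled e Q n : compact e -> e `<=` realAxis R -> ~ finite_set e ->
  Q \is monic -> size Q = n.+1 -> exists P, [/\ size P = n.+1,
    lead_coef P = (2 / supnorm e (horner Q))%:C &
    forall z, e z -> stdint P.[z]].
Proof.
move=> ce er ie Qm Qs; set t := supnorm _ _.
have t0 : 0 < t by apply: supnorm_gt0 => //; exact: monic_neq0.
pose T := \poly_(i < n.+1) (Re Q`_i)%:C.
have Qn : Q`_n = 1 by have /eqP := Qm; rewrite /lead_coef Qs.
have Tn : (Re Q`_n)%:C != 0 by rewrite Qn oner_eq0.
have Ts : size T = n.+1 by rewrite size_poly_eq.
have Tl : lead_coef T = 1 by rewrite lead_coef_poly// Qn.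
have TE (x : R) : T.[x%:C] = (Re Q.[x%:C])%:C.
  rewrite horner_poly horner_coef Qs.
  rewrite (big_morph (@complex.Re R) (id1 := 0) (op1 := +%R)) =>
    [|[? ?] [? ?]//|//].
  rewrite rmorph_sum; apply: eq_bigr => i _; rewrite -rmorphXn -rmorphM /=.
  by case: (Q`_i) => a b /=; rewrite mulr0 subr0.
have c0 : (2 / t)%:C != 0 by rewrite fmorph_eq0 mulf_neq0 ?invr_eq0 ?gt_eqF.
exists ((2 / t)%:C *: T); split; first by rewrite size_scale.
  by rewrite lead_coefZ Tl mulr1.
move=> z ez; have [x _ xz] := er z ez.
exists (2 / t * Re Q.[z]); last by rewrite hornerZ -xz TE rmorphM.
have : `|Re Q.[z]| <= t by rewrite (le_trans (normc_ge_normRe _))// le_supnorm.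
rewrite /= in_itv /= ler_norml => /andP[q1 q2]; apply/andP; split.
  rewrite -(ler_pM2r t0) mulrAC divfK ?gt_eqF//; lra.
rewrite -(ler_pM2r t0) mulrAC divfK ?gt_eqF//; lra.
Qed.

End Chebyshev.


Theorem theorem1p1 (R : realType) (e : set R[i]^o) (n : nat) (Tn : {poly R[i]})
    (e_compact : compact e) (e_real : e `<=` realAxis R)
    (e_infinite : ~ finite_set e) (n_ge1 : (1 <= n)%N)
    (Tn_cheb : is_chebyshev e n Tn) :
  supnorm e (horner Tn) = 2 * capacity e ^+ n <->
  exists P : {poly R[i]}, size P = n.+1 /\
    e = (horner P) @^-1` [set x%:C | x in `[(-2 : R), 2]].
Proof.
have [Tm Ts Tmin] := Tn_cheb.
have t0 : 0 < supnorm e (horner Tn) by apply: supnorm_gt0 => //;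
  exact: monic_neq0.
have [P [Ps Pl eP]] := real_rescaled e_compact e_real e_infinite Tm Ts.
set t := supnorm e (horner Tn) in t0 Pl *.
have Plt : (normc (lead_coef P))^-1 = t / 2.
  by rewrite Pl normc_real gtr0_norm ?divr_gt0// invf_div.
split=> [tC|[Q [Qs eQ]]].
  exists P; split => //; apply/seteqP; split => [z /eP //|z0 Pz0].
  apply: contrapT => ez0.
  (* A point of the preimage outside [e] would give C(e)^n < t / 2, against the assumed equality. *)
  have := capacity_lt_lead e_compact e_real n_ge1 Ps eP Pz0 ez0.
  by rewrite Plt tC [2 * _]mulrC mulfK ?ltxx// pnatr_eq0.
have eQ' z : e z <-> stdint Q.[z] by rewrite [in X in X <-> _]eQ.
have Cge := capacity_ge_lead e_compact e_real n_ge1 Qs eQ'.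
have Cle := capacity_le_lead e_compact n_ge1 Ps eP.
set c := normc (lead_coef Q) in Cge.
have c0 : 0 < c by rewrite normc_gt0 lead_coef_eq0 -size_poly_gt0 Qs.
have [Rm Rs] := monic_scale Qs.
(* Q divided by its leading coefficient is a monic competitor of modulus at most 2 / c on [e]. *)
have tc : t <= 2 / c.
  apply: le_trans (Tmin _ Rm Rs) _; apply: ge_sup.
    have [z ez] : e !=set0 by apply/set0P/eqP => e0; apply: e_infinite;
      rewrite e0.
    by exists (normc ((lead_coef Q)^-1 *: Q).[z]), z.
  move=> _ [z ez <-]; rewrite hornerZ Normc.normcM Normc.normcV mulrC.
  by rewrite ler_wpM2r ?invr_ge0 ?(ltW c0)//; apply/normc_stdint/eQ'.
apply/eqP; rewrite eq_le; apply/andP; split; last first.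
  by rewrite mulrC -ler_pdivlMr// -Plt.
by rewrite (le_trans tc)// ler_pM2l.
Qed.
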